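(* Let $\mathcal{L}$ be a finite bounded, graded poset of positive rank $n$. (a) We have $$h_{\mathrm{Pyr}(\mathcal{L})}(x) = (1+nx)\, h_{\mathcal{L}}(x) + (x-x^2)\, h'_{\mathcal{L}}(x),$$ $$h_{\mathrm{Prism}(\mathcal{L})}(x) = (1+(2n-1)x)\, h_{\mathcal{L}}(x) + 2(x-x^2)\, h'_{\mathcal{L}}(x) = 2\, h_{\mathrm{Pyr}(\mathcal{L})}(x) - (1+x)\, h_{\mathcal{L}}(x).$$ (b) Assume that $\mathcal{L}$ is Cohen--Macaulay. If $h_{\mathcal{L}}(x)$ is real-rooted, then $h_{\mathrm{Pyr}(\mathcal{L})}(x)$ and $h_{\mathrm{Prism}(\mathcal{L})}(x)$ are also real-rooted and each of them is interlaced by $h_{\mathcal{L}}(x)$.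
   Context: A poset is bounded if it has a minimum element $\hat 0$ and a maximum element $\hat 1$; it is graded of rank $n$ if all its maximal chains have exactly $n+1$ elements. It is Cohen--Macaulay if its order complex (the simplicial complex of all its chains) is Cohen--Macaulay over $\mathbb{Q}$. For a finite poset $\mathcal{L}$, $h_{\mathcal{L}}(x) = (1-x)^N p_{\mathcal{L}}\left(\frac{x}{1-x}\right)$, where $p_{\mathcal{L}}(x) = \sum_{k\ge 0} c_k(\mathcal{L}) x^k$, $c_k(\mathcal{L})$ is the number of $k$-element chains of $\mathcal{L}$, and $N$ is the largest cardinality of a chain in $\mathcal{L}$. $h'_{\mathcal{L}}$ denotes the derivative. Let $\mathcal{L}_1$ be the $2$-element chain and $\mathcal{L}_2 = \mathcal{L}_1 \times \mathcal{L}_1$ (products carry the componentwise order). The pyramid over $\mathcal{L}$ is $\mathrm{Pyr}(\mathcal{L}) = \mathcal{L} \times \mathcal{L}_1$, and the prism $\mathrm{Prism}(\mathcal{L})$ is the poset obtained by adding a minimum element to $(\mathcal{L} \setminus \{\hat{0}\}) \times (\mathcal{L}_2 \setminus \{\hat{0}\})$. A real polynomial is real-rooted if it is zero or all its roots are real. A real-rooted polynomial $f$ with roots $\alpha_1 \ge \alpha_2 \ge \cdots$ (with multiplicity) interlaces a real-rooted polynomial $g$ with roots $\beta_1 \ge \beta_2 \ge \cdots$ (equivalently, $g$ is interlaced by $f$) if $\cdots \le \alpha_2 \le \beta_2 \le \alpha_1 \le \beta_1$ (so $\deg g \in \{\deg f, \deg f + 1\}$); by convention the zero polynomial interlaces and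 is interlaced by every real-rooted polynomial. *)

(* Defs.v *)
From HB Require Import structures.
From mathcomp Require Import all_boot all_order all_algebra.
From mathcomp Require Import reals complex.
Set Implicit Arguments.
Unset Strict Implicit.
Unset Printing Implicit Defensive.
Import Order.TTheory GRing.Theory Num.Theory.
Local Open Scope ring_scope.

Section Chains.
Context {d : Order.disp_t}.
Implicit Type L : finPOrderType d.

Definition is_chain L (C : {set L}) : bool :=
  [forall x in C, forall y in C, (x >=< y)%O].

Definition is_max_chain L (C : {set L}) : bool := maxset (@is_chain L) C.

Definition graded_of_rank L (n : nat) : Prop :=
  forall C : {set L}, is_max_chain C -> #|C| = n.+1.

Definition num_chains L (k : nat) : nat :=
  #|[set C : {set L} | is_chain C & #|C| == k]|.

Definition max_chain_card L : nat := (\max_(C : {set L} | is_chain C) #|C|)%N.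

(* Chains of [L] have at most [#|L|] elements, so the bound is harmless. *)
Definition chain_poly (R : nzRingType) L : {poly R} :=
  \poly_(k < #|L|.+1) (num_chains L k)%:R.

(* (1 - x)^N p(x / (1 - x)), with the denominators cleared termwise; this is
   legitimate as [p] has degree at most [N]. See [horner_h_poly]. *)
Definition h_poly (R : nzRingType) L : {poly R} :=
  let N := max_chain_card L in
  \sum_(k < N.+1) (chain_poly R L)`_k *: ('X^k * (1 - 'X) ^+ (N - k)).

Lemma is_chain_card L (C : {set L}) : is_chain C -> (#|C| <= max_chain_card L)%N.
Proof. exact: (@leq_bigmax_cond _ _ (fun C : {set L} => #|C|)). Qed.

Lemma max_chain_card_le L : (max_chain_card L <= #|L|)%N.
Proof. by apply/bigmax_leqP => C _; exact: max_card. Qed.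

Lemma num_chains_gt L k : (max_chain_card L < k)%N -> num_chains L k = 0%N.
Proof.
move=> Nk; apply/eqP; rewrite cards_eq0; apply/eqP/setP => C; rewrite !inE.
apply/negP => /andP[chC /eqP cC].
by move: (is_chain_card chC); rewrite cC leqNgt Nk.
Qed.

Lemma coef_chain_poly (R : nzRingType) L k :
  (chain_poly R L)`_k = (num_chains L k)%:R.
Proof.
rewrite coef_poly; case: ltnP => // Lk.
by rewrite num_chains_gt// (leq_ltn_trans (max_chain_card_le L)).
Qed.

Lemma horner_h_poly (F : fieldType) L (x : F) : x != 1 ->
  (h_poly F L).[x] =
  (1 - x) ^+ max_chain_card L * (chain_poly F L).[x / (1 - x)].
Proof.
rewrite eq_sym -subr_eq0 => x1.
have sz : (size (chain_poly F L) <= (max_chain_card L).+1)%N.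
  by apply/leq_sizeP => k Nk; rewrite coef_chain_poly num_chains_gt.
rewrite /h_poly horner_sum (horner_coef_wide _ sz) mulr_sumr.
apply: eq_bigr => -[k /= kN] _; rewrite hornerZ hornerM hornerXn.
rewrite horner_exp hornerD hornerN hornerC hornerX [RHS]mulrCA expr_div_n.
congr (_ * _); rewrite [RHS]mulrCA; congr (_ * _).
by rewrite expfB_cond// (negPf x1).
Qed.

End Chains.

Section AdjoinBottom.
Context {d : Order.disp_t} (T : finPOrderType d).

Definition with_bot : Type := option T.

HB.instance Definition _ := Finite.on with_bot.

Definition with_bot_le (x y : with_bot) : bool :=
  match x, y with
  | None, _ => true
  | Some _, None => false
  | Some a, Some b => (a <= b)%O
  end.

Lemma with_bot_le_refl : reflexive with_bot_le.
Proof. by case=> /=. Qed.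

Lemma with_bot_le_anti : antisymmetric with_bot_le.
Proof. by move=> [a|] [b|] //= /le_anti ->. Qed.

Lemma with_bot_le_trans : transitive with_bot_le.
Proof. by move=> [b|] [a|] [c|] //=; exact: le_trans. Qed.

HB.instance Definition _ := Order.Le_isPOrder.Build d with_bot
  with_bot_le_refl with_bot_le_anti with_bot_le_trans.

End AdjoinBottom.

Section NonBottom.
Context {d : Order.disp_t} (L : finTBPOrderType d).

Definition non_bot : Type := {x : L | x != \bot%O}.

HB.instance Definition _ := SubFinite.on non_bot.
HB.instance Definition _ := [SubChoice_isSubPOrder of non_bot by <: with d].

End NonBottom.

(* [bool], with [false < true], is the 2-element chain, and [*p] is the product
   with componentwise order. *)
Definition pyr {d : Order.disp_t} (L : finTBPOrderType d) : finPOrderType _ :=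
  (L *p bool)%type.

Definition prism {d : Order.disp_t} (L : finTBPOrderType d)
  : finPOrderType _ :=
  with_bot (non_bot L *p non_bot (bool *p bool)%type)%type.

(* A simplicial complex on (a subset of) the vertex set [V] is its set of
   faces, which includes the empty one. A [k]-element face has dimension
   [k - 1]; below, faces and chains are indexed by [k] rather than by [k - 1],
   so that degree -1 of the augmented chain complex is [k = 0]. *)
Section SimplicialComplexes.
Context (F : fieldType) (V : finType).
Implicit Types (K : {set {set V}}) (s : {set V}) (c z : {ffun {set V} -> F}).

Definition link K s : {set {set V}} :=
  [set t : {set V} | [disjoint t & s] & (t :|: s) \in K].

Definition max_face_card K : nat := (\max_(s in K) #|s|)%N.

(* The chains of [K] in homological degree [k - 1]. *)
Definition simplicial_chain K (k : nat) c : Prop :=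
  forall s, c s != 0 -> s \in K /\ #|s| = k.

(* Faces are oriented by the enumeration order of [V]: the coefficient of
   [t :\ x] in the boundary of [t] is [(-1) ^ i], [i] being the position of [x]
   in [t]. *)
Definition boundary c : {ffun {set V} -> F} :=
  [ffun s => \sum_(x in ~: s)
    (-1) ^+ #|[set y in s | (enum_rank y < enum_rank x)%N]| * c (x |: s)].

(* Vanishing of the reduced homology of [K] over [F] in degree [k - 1]. *)
Definition reduced_homology_eq0 K (k : nat) : Prop :=
  forall z, simplicial_chain K k z -> boundary z = 0 ->
  exists2 c, simplicial_chain K k.+1 c & boundary c = z.

Definition cohen_macaulay_complex K : Prop :=
  forall s, s \in K -> forall k, (k < max_face_card (link K s))%N ->
  reduced_homology_eq0 (link K s) k.

End SimplicialComplexes.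

Definition order_complex {d : Order.disp_t} (L : finPOrderType d)
  : {set {set L}} := [set C | is_chain C].

Definition cohen_macaulay {d : Order.disp_t} (L : finPOrderType d) : Prop :=
  cohen_macaulay_complex rat (order_complex L).

Section Interlacing.
Context {R : realType}.
Implicit Types f g : {poly R}.

Definition real_rooted f : Prop :=
  f = 0 \/
  forall z : R[i], root (map_poly (real_complex R) f) z -> complex.Im z = 0.

(* [s] lists the roots of [f], with multiplicities, in weakly decreasing
   order. *)
Definition decreasing_roots f (s : seq R) : Prop :=
  sorted >=%R s /\ f = lead_coef f *: \prod_(a <- s) ('X - a%:P).

Definition interlacing_seqs (s t : seq R) : Prop :=
  [/\ size t = size s \/ size t = (size s).+1,
      forall i, (i < size s)%N -> s`_i <= t`_i
    & forall i, (i.+1 < size t)%N -> t`_i.+1 <= s`_i].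

Definition interlaces f g : Prop :=
  [/\ real_rooted f, real_rooted g
    & [\/ f = 0, g = 0
        | exists s t, [/\ decreasing_roots f s, decreasing_roots g t
                        & interlacing_seqs s t]]].

End Interlacing.

(* Main.v *)
(* (a) If T consists of a top element and an antichain of m further elements, a
   chain of P x T is a chain of P labelled by T, possibly with one doubled
   element; counting labellings gives p_{P x T} = p_P + m (x + x^2) p_P', which
   becomes (1 - x) h_P + m ((x - x^2) h_P' + N x h_P) for h.  Adding a minimum
   does not change h, so the pyramid is the case P = L, m = 1, and the prism is
   the case P = L \ {0}, m = 2.

   (b) Colour the elements of L by their height.  Deleting a colour class from a
   complex whose links have vanishing homology below the top degree preserves
   this property, so the subposet L_S selected by a set S of colours has homology
   only in the top degree, and its Euler characteristic has a constant sign.  As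
   h_L is the sum over S of these Euler characteristics (up to sign) times
   x^|S|, its coefficients are nonnegative and its roots a_1 >= a_2 >= ... are
   negative.  For g = (1 + c x) h + m (x - x^2) h' with c > m deg h, the signs of
   g at 0, the distinct a_i and -oo alternate once the common factor of h and h'
   is removed, which locates all the roots of g; the common roots are then put
   back.  Here c = n or 2n - 1, and deg h <= n - 1 because L \ {0} is a cone. *)
Require Import Defs.
From HB Require Import structures.
From mathcomp Require Import all_boot all_order all_algebra.
From mathcomp Require Import reals.
From mathcomp Require Import boolp complex polyrcf ring lra zify.
Import Order.TTheory GRing.Theory Num.Theory.
Local Open Scope ring_scope.

Set Implicit Arguments.
Unset Strict Implicit.
Unset Printing Implicit Defensive.

(** * Chains of products and of cones *)

Section ChainSums.
Context {d : Order.disp_t}.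
Implicit Type L : finPOrderType d.

Lemma is_chainP L (C : {set L}) :
  reflect {in C &, forall x y, (x >=< y)%O} (is_chain C).
Proof.
apply: (iffP forall_inP) => [H x y xC yC|H x xC].
  by move/forall_inP: (H x xC); apply.
by apply/forall_inP => y yC; apply: H.
Qed.

Lemma is_chainS L (C D : {set L}) : C \subset D -> is_chain D -> is_chain C.
Proof.
move=> /subsetP CD /is_chainP cD; apply/is_chainP => x y /CD xD /CD yD.
exact: cD.
Qed.

Lemma is_chain_set0 L : is_chain (set0 : {set L}).
Proof. by apply/is_chainP => x y; rewrite inE. Qed.

Lemma max_chain_exists L : exists2 C : {set L}, is_chain C & #|C| = max_chain_card L.
Proof.
have [|C cC maxC] := @eq_bigmax_cond _ (@is_chain d L) (fun C : {set L} => #|C|).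
  by apply/card_gt0P; exists set0; apply: is_chain_set0.
by exists C.
Qed.

Lemma graded_max_chain_card L n : graded_of_rank L n -> max_chain_card L = n.+1.
Proof.
move=> L_graded; have [C cC cardC] := max_chain_exists L.
rewrite -cardC; apply: L_graded; apply/maxsetP; split=> // D cD CD.
by apply/esym/eqP; rewrite eqEcard CD cardC is_chain_card.
Qed.

(** With one summand per chain instead of one per cardinality, every correspondence between chains
    becomes an identity between polynomials. *)
Lemma h_polyE (R : comNzRingType) L : h_poly R L =
  \sum_(C : {set L} | is_chain C)
    'X^#|C| * (1 - 'X) ^+ (max_chain_card L - #|C|).
Proof.
rewrite /h_poly; set N := max_chain_card L.
rewrite (partition_big (fun C : {set L} => inord #|C| : 'I_N.+1) predT) //=.
apply: eq_bigr => k _.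
rewrite (eq_bigr (fun=> 'X^k * (1 - 'X) ^+ (N - k))); last first.
  move=> C /andP[cC /eqP <-].
  by rewrite inordK // ltnS is_chain_card.
rewrite sumr_const coef_chain_poly scaler_nat; congr (_ *+ _).
apply: eq_card => C; rewrite !inE [RHS]/in_mem /=.
apply: andb_id2l => cC; rewrite -val_eqE /= inordK // ltnS.
exact: is_chain_card.
Qed.

End ChainSums.

(** The image, under the passage from [p] to [h], of the operator [x d/dx], which weights a chain by
    the number of ways to choose one of its elements. *)
Lemma deriv_h_term (R : comNzRingType) N k : (k <= N)%N ->
  let u := 'X^k * (1 - 'X) ^+ (N - k) : {poly R} in
  ('X - 'X^2) * u^`() + N%:R *: ('X * u) = u *+ k.
Proof.
move=> kN; have [j ->] : exists j, N = (k + j)%N by exists (N - k)%N; rewrite subnKC.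
rewrite addKn /= derivM derivXn deriv_exp !derivE sub0r scaler_nat.
(* The truncated [k.-1] is harmless: for [k = 0] the factor [k] kills the term. *)
have Xk : 'X * ('X^(k.-1) *+ k) = ('X^k : {poly R}) * k%:R.
  by case: (k) => [|k']; rewrite /= ?mulr0 // mulrnAr -exprS mulr_natr.
have Yj : (1 - 'X) * (-1 * (1 - 'X) ^+ j.-1 *+ j) = - ((1 - 'X) ^+ j * j%:R) :> {poly R}.
  by case: (j) => [|j']; rewrite /= ?mulr0 ?oppr0 // mulN1r mulrnAr mulrN -exprS mulr_natr mulNrn.
have -> : 'X - 'X^2 = 'X * (1 - 'X) :> {poly R} by rewrite mulrBr mulr1 expr2.
rewrite -[X in _ + X = _]mulr_natr natrD -[RHS]mulr_natr.
move: Xk Yj; move: ('X^(k.-1) *+ k) (-1 * _ *+ _) => a b.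
move: ('X^k : {poly R}) ((1 - 'X : {poly R}) ^+ j) (k%:R : {poly R}) (j%:R : {poly R}).
move=> u v p q Xk Yj.
transitivity ((1 - 'X) * ('X * a) * v + 'X * u * ((1 - 'X) * b) + 'X * (u * v) * (p + q)).
  by move: ('X : {poly R}) => x; ring.
by rewrite Xk Yj; move: ('X : {poly R}) => x; ring.
Qed.

(** * Chains of a product with an antichain topped by one element *)

Section ProductWithTopped.
Context {d1 d2 d3 : Order.disp_t} (P : finPOrderType d1) (T : finPOrderType d2).
Variable t1 : T.
Hypothesis le_t1 : forall a, (a <= t1)%O.
Hypothesis anti_t1 : forall a b, a != t1 -> b != t1 -> (a >=< b)%O -> a = b.

Local Notation PT := (P *prod[d3] T)%type.

(* A chain of [P x T] is obtained from its projection [C] to [P] by labelling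
   the elements up to some [c] with a fixed non-top [a], and the elements beyond
   [c] with the top; the element [c] is moreover doubled if [e] is true. *)
Definition label_chain (j : {set P} * option (T * P * bool)) : {set PT} :=
  [set p | (p.1 \in j.1) &&
    (if j.2 is Some (a, c, e) then
       if p.1 == c then (p.2 == a) || e && (p.2 == t1)
       else if (p.1 < c)%O then p.2 == a else p.2 == t1
     else p.2 == t1)].

Definition labelling (j : {set P} * option (T * P * bool)) : bool :=
  is_chain j.1 && (if j.2 is Some (a, c, e) then (a != t1) && (c \in j.1) else true).


Lemma label_chain_proj j x : labelling j ->
  (x \in j.1) = [exists b, ((x, b) : PT) \in label_chain j].
Proof.
case: j => C [[[a c] e]|] /andP[/= cC H]; apply/idP/existsP => [xC|[b]].
- exists (if (x <= c)%O then a else t1).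
  rewrite inE /= xC le_eqVlt; case: (x == c) => //=; first by rewrite eqxx.
  by case: (x < c)%O => /=.
- by rewrite inE => /andP[].
- by exists t1; rewrite inE /= xC /=.
- by rewrite inE => /andP[].
Qed.

Lemma label_chain_is_chain j : labelling j -> is_chain (label_chain j).
Proof.
case: j => C [[[a c] e]|] /andP[/= /is_chainP cC H]; apply/is_chainP; last first.
  move=> [x b] [y b']; rewrite !inE /= => /andP[xC /eqP ->] /andP[yC /eqP ->].
  by rewrite /Order.comparable !leEprod /= !lexx !andbT; apply: cC.
move=> p q; wlog le_pq : p q / (p.1 <= q.1)%O.
  move=> W pD qD; have pC : p.1 \in C by move: pD; rewrite inE => /andP[].
  have qC : q.1 \in C by move: qD; rewrite inE => /andP[].
  case/orP: (cC _ _ pC qC) => /W; first exact.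
  by rewrite comparable_sym; apply.
case/andP: H => at1 cC0.
rewrite !inE => /andP[pC Hp] /andP[qC Hq].
move: le_pq; rewrite le_eqVlt => /orP[/eqP eqpq|ltpq].
  rewrite /Order.comparable !leEprod eqpq lexx /=; move: Hp Hq; rewrite eqpq.
  case: ifP => _; last by case: ifP => _ /eqP -> /eqP ->; rewrite lexx.
  by move=> /orP[/eqP->|/andP[_ /eqP ->]] /orP[/eqP->|/andP[_ /eqP ->]];
    rewrite ?lexx ?le_t1 ?orbT.
apply/orP; left; rewrite leEprod (ltW ltpq) /=.
(* Labels can only rise from [a] to the top along the chain: if [q] is not labelled by the top, it
   lies at or below [c], so [p] lies strictly below [c] and carries [a] too. *)
have [->|nt1] := eqVneq q.2 t1; first exact: le_t1.
have [le_qc qa] : (q.1 <= c)%O /\ q.2 = a.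
  move: Hq; case: eqVneq => [-> /orP[/eqP ->|/andP[_]] //|_].
    by rewrite (negPf nt1).
  by case: ifP => [/ltW -> /eqP|_]; rewrite ?(negPf nt1).
have ltpc := lt_le_trans ltpq le_qc.
by move: Hp; rewrite (lt_eqF ltpc) ltpc qa => /eqP ->.
Qed.

Lemma label_chain_card j : labelling j ->
  #|label_chain j| = (#|j.1| + (if j.2 is Some (_, _, e) then e : nat else 0))%N.
Proof.
move=> lj; rewrite -sum1_card big_mkcond /=.
rewrite (eq_bigr (fun p : PT => (if (p.1, p.2) \in label_chain j then 1 else 0)%N));
  last by case.
rewrite -(pair_big predT predT (fun x b => if ((x, b) : PT) \in label_chain j then 1 else 0)%N) /=.
case: j lj => C [[[a c] e]|] /andP[/= cC H]; last first.
  rewrite addn0 -sum1_card [RHS]big_mkcond; apply: eq_bigr => x _.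
  rewrite (eq_bigr (fun b => if b == t1 then (x \in C : nat) else 0%N)).
    by rewrite -big_mkcond big_pred1_eq; case: (x \in C).
  by move=> b _; rewrite inE /=; case: (b == t1); case: (x \in C).
case/andP: H => at1 cC0.
rewrite -sum1_card [in RHS]big_mkcond (bigD1 c) //= [X in _ = (X + _)%N](bigD1 c) //= cC0.
rewrite addnAC; congr (_ + _)%N; last first.
  apply: eq_bigr => x xc.
  have [b Hb] : exists b0, forall b, (((x, b) : PT) \in label_chain (C, Some (a, c, e)))
     = (x \in C) && (b == b0).
    exists (if (x < c)%O then a else t1) => b; rewrite inE /= (negPf xc).
    by case: ifP.
  rewrite (eq_bigr (fun b' => if b' == b then (x \in C : nat) else 0%N)).
    by rewrite -big_mkcond big_pred1_eq; case: (x \in C).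
  by move=> b' _; rewrite Hb; case: (b' == b); case: (x \in C).
rewrite (bigD1 a) //= (bigD1 t1) /=; last by rewrite eq_sym.
rewrite big1 => [|b /andP[ba bt]].
  by rewrite !inE /= !eqxx cC0 /= andbT orbC; case: e; rewrite //= eq_sym (negPf at1).
by rewrite inE /= eqxx (negPf ba) (negPf bt) andbF andbF.
Qed.

(** The pair [(c, a)] is the largest element of [D] with a non-top label, so [D] determines [a], [c]
    and [e]; injectivity rests on this. *)
Lemma label_chain_maxP C a c e : labelling (C, Some (a, c, e)) ->
  let D := label_chain (C, Some (a, c, e)) in
  [/\ ((c, a) : PT) \in D, (((c, t1) : PT) \in D) = e &
    forall x b, ((x, b) : PT) \in D -> b != t1 -> b = a /\ (x <= c)%O].
Proof.
move=> /andP[/= _ /andP[at1 cC]]; split.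
- by rewrite inE /= !eqxx cC.
- by rewrite inE /= !eqxx cC andbT eq_sym (negPf at1).
move=> x b; rewrite inE /= => /andP[xC H] bt; move: H; rewrite le_eqVlt.
case: (x == c) => /=; first by rewrite (negPf bt) andbF orbF => /eqP.
by case: ifP => _; [move=> /eqP|rewrite (negPf bt)].
Qed.

Lemma label_chain_inj : {in labelling &, injective label_chain}.
Proof.
move=> j j' lj lj' E.
have E1 : j.1 = j'.1 by apply/setP => x; rewrite !label_chain_proj // E.
have top C D : labelling (C, None) -> labelling (C, Some D) ->
    label_chain (C, None) = label_chain (C, Some D) -> False.
  case: D => -[a c] e _ lD EE; have [H _ _] := label_chain_maxP lD.
  move: H; rewrite -EE inE /= => /andP[_ /eqP at1].
  by move: lD; rewrite /labelling /= at1 eqxx andbF.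
case: j j' E1 lj lj' E => C o [C' o'] /= <- {C'}.
case: o o' => [[[a c] e]|] [[[a' c'] e']|] lj lj' E //.
- have [H1 H2 H3] := label_chain_maxP lj; have [H1' H2' H3'] := label_chain_maxP lj'.
  move: (lj) (lj') => /and3P[_ /= at1 _] /and3P[_ /= at1' _].
  rewrite -E in H1' H2' H3'.
  have [aa' cc'] := H3' _ _ H1 at1; have [_ c'c] := H3 _ _ H1' at1'.
  have {}cc' : c = c' by apply/le_anti; rewrite cc'.
  by rewrite -H2 -H2' aa' cc'.
- by case: (top C (a, c, e)).
- by case: (top C (a', c', e')).
Qed.

Lemma label_chain_surj (D : {set PT}) : is_chain D ->
  exists2 j, labelling j & D = label_chain j.
Proof.
move=> /is_chainP cD; pose C : {set P} := [set p.1 | p in D].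
have cC : is_chain C.
  apply/is_chainP => _ _ /imsetP[p pD ->] /imsetP[q qD ->].
  by case/orP: (cD _ _ pD qD); rewrite leEprod => /andP[H _]; rewrite /Order.comparable H ?orbT.
have inC x b : ((x, b) : PT) \in D -> x \in C by move=> H; apply/imsetP; exists (x, b).
have [/existsP[p0 p0D]|/existsPn H] := boolP [exists p : PT, (p \in D) && (p.2 != t1)]; last first.
  exists (C, None); first by rewrite /labelling /= cC.
  apply/setP => -[x b]; rewrite inE /=; apply/idP/andP => [xD|[/imsetP[[y b'] yD /= ->] /eqP ->]].
    by split; [exact: inC xD|move: (H (x, b)); rewrite xD /= negbK].
  by move: (H (y, b')); rewrite yD /= negbK => /eqP <-.
(* The size of a principal ideal is a numerical proxy for the order: a maximiser of [dn] among the
   elements with a non-top label is the largest of them, since their first components are pairwise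
   comparable. *)
pose dn (p : PT) := #|[set y | (y <= p.1)%O]|.
case: (@arg_maxnP PT p0 (fun p => (p \in D) && (p.2 != t1)) dn p0D) => -[c a].
move=> /andP[/= caD at1] cmax.
have belowc x b : ((x, b) : PT) \in D -> b != t1 -> b = a /\ (x <= c)%O.
  move=> xD bt; have cmp := cD _ _ caD xD.
  have ba : b = a.
    apply: anti_t1 => //; case/orP: cmp; rewrite leEprod => /andP[_ /= H];
    by rewrite /Order.comparable H ?orbT.
  split=> //; case/orP: cmp; rewrite leEprod /= => /andP[H _] //.
  move: H; rewrite le_eqVlt => /orP[/eqP -> //|ltcx].
  have := cmax (x, b); rewrite xD /= bt => /(_ isT); rewrite leqNgt => /negP[].
  apply: proper_card; apply/properP; split.
    by apply/subsetP => y; rewrite !inE => /le_trans; apply; apply: ltW.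
  by exists x; rewrite !inE // lt_geF.
have abovec x : ((x, t1) : PT) \in D -> (c <= x)%O.
  move=> xD; case/orP: (cD _ _ caD xD); rewrite leEprod /= => /andP[] // _ t1a.
  by case/eqP: at1; apply/le_anti; rewrite t1a le_t1.
exists (C, Some (a, c, ((c, t1) : PT) \in D)).
  by rewrite /labelling /= cC at1 (inC _ _ caD).
apply/setP => -[x b]; rewrite inE /=; apply/idP/andP => [xD|[]].
  split; first exact: inC xD.
  have [bt|bt] := eqVneq b t1; last first.
    have [-> ] := belowc _ _ xD bt; rewrite le_eqVlt.
    by case: (x == c) => /=; rewrite ?eqxx // => ->.
  rewrite bt in xD *; case: eqVneq => [xc|xc]; first by rewrite -xc xD orbT.
  by case: ifP => [|_]; [rewrite le_gtF // abovec|].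
case/imsetP => -[y b'] yD /= ->; case: eqVneq => [->|yc].
  by move=> /orP[/eqP ->|/andP[H /eqP ->]].
have [bt|bt] := eqVneq b' t1.
  by rewrite bt in yD; rewrite le_gtF ?(abovec _ yD) // => /eqP ->.
have [ba] := belowc _ _ yD bt; rewrite le_eqVlt (negPf yc) /= => -> /eqP ->.
by rewrite -ba.
Qed.

(** The option [None] accounts for the lone [F #|C|]; otherwise [c] in [C] and a non-top [a] are
    chosen freely, and [e] decides between [#|C|] and [#|C|.+1] elements. *)
Lemma sum_chains_prod (V : nmodType) (F : nat -> V) :
  \sum_(D : {set PT} | is_chain D) F #|D| =
  \sum_(C : {set P} | is_chain C)
    (F #|C| + (F #|C| + F #|C|.+1) *+ (#|C| * #|[pred a | a != t1]|)).
Proof.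
transitivity (\sum_(D in label_chain @: [set j | labelling j]) F #|D|).
  apply: eq_bigl => D; apply/idP/imsetP => [/label_chain_surj[j lj ->]|[j]].
    by exists j; rewrite ?inE.
  by rewrite inE => lj ->; apply: label_chain_is_chain.
rewrite big_imset /=; last first.
  by move=> i j; rewrite !inE; apply: label_chain_inj.
rewrite (eq_bigl labelling) => [|j]; last by rewrite inE.
rewrite (eq_bigr (fun j : {set P} * option (T * P * bool) =>
    F (#|j.1| + (if j.2 is Some (_, _, e) then e : nat else 0))%N));
  last by move=> j lj; rewrite label_chain_card.
rewrite -(pair_big_dep (@is_chain d1 P)
  (fun C o => if o is Some (a, c, e) then (a != t1) && (c \in C) else true)
  (fun C (o : option (T * P * bool)) =>
    F (#|C| + (if o is Some (_, _, e) then e : nat else 0))%N)) /=.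
apply: eq_bigr => C cC.
rewrite (bigD1 None) //= addn0; congr (_ + _).
transitivity (\sum_(j : T * P * bool | (j.1.1 != t1) && (j.1.2 \in C) && true) F (#|C| + j.2)%N).
  rewrite (reindex_omap Some id) /=; last by case.
  by apply: eq_big => [[[a c] e]|[[a c] e]] //=; rewrite eqxx !andbT.
rewrite -(pair_big (fun ac : T * P => (ac.1 != t1) && (ac.2 \in C)) predT
  (fun _ (e : bool) => F (#|C| + e)%N)) /=.
rewrite (eq_bigr (fun=> F #|C| + F #|C|.+1)) => [|ac _]; last first.
  by rewrite big_bool /= addn0 addn1 addrC.
rewrite sumr_const mulnC; congr (_ *+ _); rewrite -cardX.
by apply: eq_card => -[a c]; rewrite !inE.
Qed.

Variables (p0 : P) (a0 : T).
Hypothesis a0_neq : a0 != t1.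

Local Notation m := #|[pred a | a != t1]|.

(** A longest chain of [P] gains one element by doubling; this takes an element of [P] and a non-top
    element of [T], supplied by [p0] and [a0]. *)
Lemma max_chain_card_prod : max_chain_card PT = (max_chain_card P).+1.
Proof.
apply/eqP; rewrite eqn_leq; apply/andP; split.
  have [D cD <-] := max_chain_exists PT.
  have [j lj ->] := label_chain_surj cD.
  rewrite (label_chain_card lj) -addn1 leq_add //.
    by apply: is_chain_card; case/andP: lj.
  by case: j.2 => [[[? ?] []]|].
have [C cC cardC] := max_chain_exists P.
have /set0Pn[c cinC] : C != set0.
  rewrite -card_gt0 cardC -(cards1 p0) is_chain_card //.
  by apply/is_chainP => x y /set1P -> /set1P ->; apply: comparablexx.
have lj : labelling (C, Some (a0, c, true)) by rewrite /labelling /= cC a0_neq.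
have := is_chain_card (label_chain_is_chain lj).
by rewrite (label_chain_card lj) /= cardC addn1.
Qed.

(** For given [a] and [c], the doubled and undoubled labellings of a chain [C] add up, by
    [(1 - x) + x = 1], to the term of [C] in [h_poly R P]; the [#|C|] choices of [c] then produce
    the operator of [deriv_h_term]. *)
Lemma h_poly_prod (R : comNzRingType) :
  h_poly R PT = (1 - 'X) * h_poly R P
    + (('X - 'X^2) * (h_poly R P)^`()
       + (max_chain_card P)%:R *: ('X * h_poly R P)) *+ m.
Proof.
rewrite [LHS]h_polyE max_chain_card_prod; set N := max_chain_card P.
rewrite (sum_chains_prod
  (fun k => 'X^k * (1 - 'X) ^+ (N.+1 - k) : {poly R})).
rewrite h_polyE -/N raddf_sum /= !mulr_sumr scaler_sumr -!big_split /=.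
rewrite -sumrMnl -big_split /=; apply: eq_bigr => C /is_chain_card.
rewrite -/N; move: #|C| => k.
move=> kN; rewrite subSS subSn // [(1 - 'X) ^+ _.+1]exprS mulrnA [X in X + _]mulrCA.
congr (_ + _ *+ _); rewrite deriv_h_term // exprS; congr (_ *+ _).
by rewrite mulrCA -[X in _ + X]mulrA -mulrDl subrK mul1r.
Qed.

End ProductWithTopped.

(** * Posets with an element comparable to all others *)

Section ConePoint.
Context {d : Order.disp_t} (A : finPOrderType d) (t : A).
Hypothesis cmp_t : forall x, (x >=< t)%O.

Lemma is_chainU1 (C : {set A}) : is_chain (t |: C) = is_chain C.
Proof.
apply/idP/idP; first exact/is_chainS/subsetUr.
move=> /is_chainP cC; apply/is_chainP => x y; rewrite !inE.
move=> /predU1P[->|xC] /predU1P[->|yC]; rewrite ?cmp_t //.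
  by rewrite comparable_sym.
exact: cC.
Qed.

(** Chains come in pairs [C], [t |: C] with [t] outside [C]. *)
Lemma sum_chains_cone (V : nmodType) (F : nat -> V) :
  \sum_(C : {set A} | is_chain C) F #|C| =
  \sum_(C : {set A} | is_chain C && (t \notin C)) (F #|C|.+1 + F #|C|).
Proof.
rewrite (bigID (fun C : {set A} => t \in C)) /= big_split /=; congr (_ + _).
rewrite (reindex_onto (fun C => t |: C) (fun C => C :\ t)) /=; last first.
  by move=> C /andP[_ tC]; rewrite setD1K.
apply: eq_big => [C|C].
  rewrite is_chainU1 setU11 andbT; case: (boolP (t \in C)) => tC /=.
    rewrite andbF; apply/negbTE/nandP; right; apply/eqP => E.
    by move: tC; rewrite -E !inE eqxx.
  by rewrite setU1K // eqxx.
move=> /andP[_ /eqP E]; congr F; rewrite cardsU1 -[in X in _ \notin X]E.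
by rewrite !inE eqxx.
Qed.

Lemma max_chain_card_cone_gt (C : {set A}) : is_chain C -> t \notin C ->
  (#|C| < max_chain_card A)%N.
Proof.
move=> cC tC; rewrite (_ : #|C|.+1 = #|t |: C|); last by rewrite cardsU1 tC.
by apply: is_chain_card; rewrite is_chainU1.
Qed.

Lemma h_poly_cone (R : comNzRingType) : h_poly R A =
  \sum_(C : {set A} | is_chain C && (t \notin C))
    'X^#|C| * (1 - 'X) ^+ (max_chain_card A - #|C|.+1).
Proof.
rewrite h_polyE; set N := max_chain_card A.
rewrite (sum_chains_cone (fun k => 'X^k * (1 - 'X) ^+ (N - k) : {poly R})).
apply: eq_bigr => C /andP[cC tC].
rewrite -[(N - #|C|)%N]prednK ?subn_gt0 ?max_chain_card_cone_gt // -subnS.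
by rewrite !exprS -mulrA [X in _ + X]mulrCA -mulrDl addrC subrK mul1r.
Qed.

(** After the pairing, every remaining term has degree at most [|C| + (N - |C| - 1) = N - 1]. *)
Lemma size_h_poly_cone (R : comNzRingType) :
  (size (h_poly R A) <= max_chain_card A)%N.
Proof.
rewrite h_poly_cone; apply/(leq_trans (size_sum _ _ _))/bigmax_leqP => C /andP[cC tC].
have CN := max_chain_card_cone_gt cC tC.
apply: leq_trans (size_polyMleq _ _) _; rewrite size_polyXn /=.
have := size_poly_exp_leq (1 - 'X : {poly R}) (max_chain_card A - #|C|.+1).
have -> : size (1 - 'X : {poly R}) = 2.
  by rewrite -opprB size_polyN size_XsubC.
rewrite mul1n. move=> sz; rewrite -[leqRHS](subnKC CN) addSnnS leq_add2l. exact: sz.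
Qed.

Context {d' : Order.disp_t} (P : finPOrderType d') (f : P -> A).
Hypothesis f_mono : {mono f : x y / (x <= y)%O}.
Hypothesis f_im : forall x, (x != t) = [exists y, x == f y].

Let f_inj : injective f := inc_inj f_mono.

Lemma imset_chain (C : {set P}) : is_chain (f @: C) = is_chain C.
Proof.
apply/is_chainP/is_chainP => cC.
  move=> x y xC yC; have := cC _ _ (imset_f f xC) (imset_f f yC).
  by rewrite /Order.comparable !f_mono.
by move=> _ _ /imsetP[x xC ->] /imsetP[y yC ->]; rewrite /Order.comparable !f_mono; apply: cC.
Qed.

Lemma chains_avoiding_cone_point :
  [set C : {set A} | is_chain C && (t \notin C)] =
  [set f @: (C : {set P}) | C in [set C : {set P} | is_chain C]].
Proof.
apply/setP => C; rewrite !inE; apply/andP/imsetP => [[cC tC]|[D]].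
  have E : C = f @: (f @^-1: C).
    apply/setP => x; apply/idP/imsetP => [xC|[y]]; last by rewrite inE => ? ->.
    have : x != t by apply: contraNneq tC => <-.
    by rewrite f_im => /existsP[y /eqP E]; exists y; rewrite // inE -E.
  by exists (f @^-1: C); rewrite // inE -imset_chain -E.
rewrite inE => cD ->; rewrite imset_chain; split=> //.
apply/imsetP => -[x _ E]; have := f_im t; rewrite eqxx => /esym/existsP[].
by exists x; rewrite E.
Qed.

Lemma max_chain_card_cone : max_chain_card A = (max_chain_card P).+1.
Proof.
apply/eqP; rewrite eqn_leq; apply/andP; split.
  have [C cC <-] := max_chain_exists A.
  have : C :\ t \in [set C : {set A} | is_chain C && (t \notin C)].
    by rewrite !inE eqxx andbT (is_chainS _ cC) // subD1set.
  rewrite chains_avoiding_cone_point => /imsetP[D]; rewrite inE => cD E.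
  rewrite (cardsD1 t C) E card_imset //.
  by have := is_chain_card cD; case: (t \in C); lia.
have [C cC <-] := max_chain_exists P; rewrite -(card_imset _ f_inj).
have : f @: C \in [set C : {set A} | is_chain C && (t \notin C)].
  by rewrite chains_avoiding_cone_point; apply: imset_f; rewrite inE.
by rewrite inE => /andP[]; exact: max_chain_card_cone_gt.
Qed.

(** The chains left by the pairing are those of [A] without [t]. Presenting this poset by an
    embedding [f] lets the lemma serve both for deleting a minimum ([val]) and for adding one
    ([Some]). *)
Lemma h_poly_cone_base (R : comNzRingType) : h_poly R A = h_poly R P.
Proof.
rewrite h_poly_cone h_polyE max_chain_card_cone.
rewrite -(eq_bigl _ _ (fun C => in_set (fun C : {set A} => is_chain C && (t \notin C)) C)).
rewrite chains_avoiding_cone_point big_imset /=; last first.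
  by move=> C D _ _; apply: imset_inj.
by apply: eq_big => [C|C _]; rewrite ?inE // card_imset // subSS.
Qed.

End ConePoint.

(** * The formulas for pyramids and prisms *)

Section PyramidsPrisms.
Context {d : Order.disp_t} (L : finTBPOrderType d) (n : nat).
Hypotheses (n_gt0 : (0 < n)%N) (L_graded : graded_of_rank L n).

Let cmp_bot (x : L) : (x >=< (\bot : L))%O.
Proof. by rewrite /Order.comparable le0x orbT. Qed.

Let val_mono : {mono (val : non_bot L -> L) : x y / (x <= y)%O}.
Proof. by []. Qed.

Let val_im (x : L) : (x != \bot%O) = [exists y : non_bot L, x == val y].
Proof.
apply/idP/existsP => [xb|[y /eqP ->]]; last exact: (valP y).
by exists (Sub x xb); rewrite SubK.
Qed.

Lemma non_bot_max_chain_card : max_chain_card (non_bot L) = n.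
Proof.
have := max_chain_card_cone cmp_bot val_mono val_im.
by rewrite (graded_max_chain_card L_graded) => -[].
Qed.

Lemma h_poly_non_bot (R : comNzRingType) : h_poly R (non_bot L) = h_poly R L.
Proof. by rewrite (h_poly_cone_base cmp_bot val_mono val_im). Qed.

Lemma bot_neq_top : (\top : L)%O != \bot%O.
Proof.
apply/eqP => tb; have /card_le1_eqP H : (#|L| <= 1)%N.
  apply/card_le1_eqP => x y _ _.
  have b z : z = \bot%O :> L by apply/le_anti; rewrite le0x -tb lex1.
  by rewrite (b x) (b y).
have := max_chain_card_le L; rewrite (graded_max_chain_card L_graded) leqNgt ltnS.
by rewrite (leq_trans _ n_gt0) //; apply/card_le1_eqP.
Qed.

Definition non_bot_top : non_bot L := Sub \top%O bot_neq_top.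

(** The minimum is removed first, which leaves chains of at most [n] elements, and the maximum is
    still a cone point; the two reductions give degree at most [n - 1]. *)
Lemma size_h_poly_graded (R : comNzRingType) : (size (h_poly R L) <= n)%N.
Proof.
rewrite -h_poly_non_bot -non_bot_max_chain_card.
apply: (@size_h_poly_cone _ _ non_bot_top) => x.
by rewrite /Order.comparable -[(x <= _)%O]val_mono SubK lex1.
Qed.

Lemma h_poly_pyr (R : comNzRingType) : h_poly R (pyr L) =
  (1 + n%:R *: 'X) * h_poly R L + ('X - 'X^2) * (h_poly R L)^`().
Proof.
rewrite (@h_poly_prod _ _ _ L bool true _ _ \bot%O false) //; last first.
- by case=> [] [].
- by case.
rewrite (graded_max_chain_card L_graded) (_ : #|_| = 1%N); last first.
  by rewrite (eq_card (B := pred1 false)) ?card1 // => -[].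
rewrite mulr1n -!mul_polyC !rmorph_nat -natr1.
move: (h_poly R L)^`() (h_poly R L) ('X : {poly R}) (n%:R) => h' h x c; ring.
Qed.


Let B2 : finTBPOrderType _ := (bool *p bool)%type.
Let b11 : non_bot B2 := exist _ (true, true) isT.
Let b10 : non_bot B2 := exist _ (true, false) isT.
Let b01 : non_bot B2 := exist _ (false, true) isT.

Let non_bot_cases (a : non_bot B2) : [\/ a = b11, a = b10 | a = b01].
Proof.
case: a => -[[] []] p; [constructor 1|constructor 2|constructor 3|by []];
exact: val_inj.
Qed.

(** The elements [b10] and [b01] of [non_bot B2] are incomparable and lie below [b11], so [m = 2],
    and the longest chains of [non_bot L] have [n] elements: [(1 - x) + 2 n x = 1 + (2 n - 1) x]. *)
Lemma h_poly_prism (R : comNzRingType) : h_poly R (prism L) =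
  (1 + (2 * n - 1)%:R *: 'X) * h_poly R L
  + 2%:R *: (('X - 'X^2) * (h_poly R L)^`()).
Proof.
rewrite /prism.
set Q := (non_bot L *p non_bot B2)%type.
transitivity (h_poly R Q).
  apply: (@h_poly_cone_base _ (with_bot Q) None _ _ Q Some).
  - by case.
  - by [].
  - case=> [x|]; last by apply/esym/existsP => -[].
    by apply/esym/existsP; exists x.
rewrite (@h_poly_prod _ _ _ (non_bot L) (non_bot B2) b11 _ _ non_bot_top b10) //; last first.
- by move=> a b; case: (non_bot_cases a) => ->; case: (non_bot_cases b) => ->.
- by move=> a; case: (non_bot_cases a) => ->.
rewrite h_poly_non_bot non_bot_max_chain_card (_ : #|_| = 2); last first.
  rewrite (eq_card (B := pred2 b10 b01)) ?card2 // => a.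
  by rewrite !inE; case: (non_bot_cases a) => ->.
rewrite -!mul_polyC !rmorph_nat natrB ?muln_gt0 // natrM -mulr_natr.
move: (h_poly R L)^`() (h_poly R L) ('X : {poly R}) (n%:R) => h' h x c; ring.
Qed.
End PyramidsPrisms.

(** * Homology of rank-selected subcomplexes *)

Section Homology.
Context (F : fieldType) (V : finType).
Implicit Types (v x : V) (K : {set {set V}}) (s t : {set V}) (c e z : {ffun {set V} -> F^o}).

Local Notation bd := (@boundary F V).

Definition incidence (x : V) s : F :=
  (-1) ^+ #|[set y in s | (enum_rank y < enum_rank x)%N]|.

Lemma boundaryE c s :
  bd c s = \sum_(x in ~: s) incidence x s * c (x |: s).
Proof. by rewrite ffunE. Qed.

Definition boundary_lin (c : {ffun {set V} -> F^o}) : {ffun {set V} -> F^o} := bd c.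

Lemma boundary_is_linear : linear boundary_lin.
Proof.
move=> a c e; apply/ffunP => s; rewrite !ffunE scaler_sumr -big_split /=.
by apply: eq_bigr => x _; rewrite !ffunE mulrDr; congr (_ + _); rewrite /GRing.scale /= mulrCA.
Qed.

HB.instance Definition _ := GRing.isLinear.Build F {ffun {set V} -> F^o}
  {ffun {set V} -> F^o} _ boundary_lin boundary_is_linear.

Lemma boundary0 : bd 0 = 0. Proof. exact: (linear0 boundary_lin). Qed.

Lemma boundaryD c e : bd (c + e) = bd c + bd e. Proof. exact: (linearD boundary_lin). Qed.

Lemma boundary_sum (I : finType) (P : pred I) (f : I -> {ffun {set V} -> F^o}) :
  bd (\sum_(i | P i) f i) = \sum_(i | P i) bd (f i).
Proof. exact: (linear_sum boundary_lin). Qed.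

Lemma incidenceU1 x y s : y \notin s ->
  incidence x (y |: s) = incidence x s * (-1) ^+ (enum_rank y < enum_rank x)%N.
Proof.
move=> ys; rewrite /incidence -exprD; congr (_ ^+ _).
rewrite -!sum1dep_card !big_mkcondr /= big_setU1 //= addnC.
by case: (_ < _)%N.
Qed.

Lemma incidenceU1xx x s : incidence x (x |: s) = incidence x s.
Proof.
have [xs|xs] := boolP (x \in s); first by rewrite (setUidPr _) // sub1set.
by rewrite incidenceU1 // ltnn mulr1.
Qed.

Lemma incidence_sqr x s : incidence x s * incidence x s = 1.
Proof. by rewrite -expr2 sqrr_sign. Qed.

(** The sign rule behind [bd (bd c) = 0]: of two distinct vertices exactly one precedes the
    other. *)
Lemma incidence_swap x y s : x \notin s -> y \notin s -> x != y ->
  incidence x s * incidence y (x |: s) = - (incidence y s * incidence x (y |: s)).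
Proof.
move=> xs ys xy; rewrite !incidenceU1 //.
have : enum_rank x != enum_rank y by rewrite (inj_eq enum_rank_inj).
by rewrite -val_eqE /=; case: ltngtP => //= _ _; ring.
Qed.

(* The join of the vertex [v] with the chain [e]. *)
Definition cone v e : {ffun {set V} -> F^o} :=
  [ffun t : {set V} => if v \in t then incidence v t * e (t :\ v) else 0].

(** The part of [c] through [v], seen as a chain on the link of [v]: [cone v (vertex_part v c)] is
    the restriction of [c] to the faces containing [v]. *)
Definition vertex_part v c : {ffun {set V} -> F^o} :=
  [ffun t : {set V} => if v \in t then 0 else incidence v t * c (v |: t)].

(** An instance of the rule [bd (v e) = e - v (bd e)] for joins with a vertex. *)
Lemma boundary_cone v e : (forall t, v \in t -> e t = 0) -> bd e = 0 ->
  bd (cone v e) = e.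
Proof.
move=> e0 de0; apply/ffunP => s; rewrite boundaryE.
have [vs|vs] := boolP (v \in s); last first.
  rewrite (bigD1 v) ?inE //= big1 => [|x /andP[_ xv]].
    rewrite addr0 ffunE setU11 setU1K // incidenceU1xx mulrA incidence_sqr.
    by rewrite mul1r.
  by rewrite ffunE !inE (negPf vs) orbF eq_sym (negPf xv) mulr0.
have {s vs} [s vs ->] : exists2 s' : {set V}, v \notin s' & s = v |: s'.
  by exists (s :\ v); rewrite ?setD1K // !inE eqxx.
rewrite [RHS]e0 ?setU11 //; transitivity (- (incidence v s * bd e s)); last first.
  by rewrite de0 ffunE mulr0 oppr0.
rewrite boundaryE [in RHS](bigD1 v) ?inE //= e0 ?setU11 // mulr0 add0r.
rewrite mulr_sumr -sumrN; apply: eq_big => [x|x].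
  by rewrite !inE negb_or andbC.
rewrite !inE negb_or => /andP[xv xs].
rewrite ffunE !inE eqxx orbT setUCA setU1K ?inE ?negb_or 1?eq_sym ?xv //.
rewrite !mulrA -mulNr incidenceU1xx; congr (_ * _).
rewrite -[incidence x _]mul1r -(incidence_sqr v s) -!mulrA.
rewrite (mulrA (incidence v s) (incidence x (v |: s))) incidence_swap 1?eq_sym // !mulNr mulrN.
by rewrite -!mulrA incidence_sqr mulr1.
Qed.

Lemma boundary_vertex_part v c t : v \notin t ->
  bd (vertex_part v c) t = - (incidence v t * bd c (v |: t)).
Proof.
move=> vt; rewrite !boundaryE (bigD1 v) ?inE //= ffunE setU11 mulr0 add0r.
rewrite mulr_sumr -sumrN; apply: eq_big => [x|x /andP[xt xv]].
  by rewrite !inE negb_or andbC.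
rewrite inE in xt.
rewrite ffunE !inE eq_sym (negPf xv) (negPf vt) /= !mulrA setUCA.
by rewrite -mulNr; congr (_ * _); apply: incidence_swap.
Qed.

(** A filling [c] of the cycle [z] in [K] is pushed off [W]. No face has two vertices in [W], so [c]
    is a chain off [W] plus one cone over [vertex_part v c] for each [v] in [W]. Each of these
    vertex parts is a cycle in the link of [v], hence a boundary there, and a filling of it within
    the link can replace the cone without changing [bd c]. *)
Lemma deletion_reduced_homology K (W : {set V}) k :
  (forall s t, s \subset t -> t \in K -> s \in K) ->
  (forall s, s \in K -> {in W &, forall v w, v \in s -> w \in s -> v = w}) ->
  reduced_homology_eq0 F K k ->
  {in W, forall v, [set v] \in K -> reduced_homology_eq0 F (link K [set v]) k} ->
  reduced_homology_eq0 F [set s in K | [disjoint s & W]] k.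
Proof.
move=> Kdown K1 HK Hlk z zK dz0.
have [s zs|c cK dc] := HK z _ dz0; first by have [] := zK s zs; rewrite inE => /andP[].
have z0 v s : v \in W -> v \in s -> z s = 0.
  move=> vW vs; apply/eqP/negPn/negP => /zK[]; rewrite inE => /andP[_ /pred0P /(_ v)].
  by rewrite /= vs vW.
(* The cycle [z] vanishes on the faces through [v], which makes the vertex part of its filling a
   cycle. *)
have dcv v : v \in W -> bd (vertex_part v c) = 0.
  move=> vW; apply/ffunP => t; have [vt|vt] := boolP (v \in t); last first.
    by rewrite boundary_vertex_part // dc (z0 v) ?setU11 // mulr0 oppr0 ffunE.
  by rewrite boundaryE ffunE big1 // => x _; rewrite ffunE !inE vt orbT mulr0.
have /fin_all_exists[e eP] v : exists e : {ffun {set V} -> F^o}, v \in W ->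
    simplicial_chain (link K [set v]) k.+1 e /\ bd e = vertex_part v c.
  have [vW|vW] := boolP (v \in W); last by exists 0.
  have [vK|vK] := boolP ([set v] \in K).
    have [|e] := Hlk v vW vK (vertex_part v c) _ (dcv v vW); last by exists e.
    move=> t; rewrite ffunE; case: ifP => [|vt]; first by rewrite eqxx.
    rewrite mulf_eq0 negb_or => /andP[_ /cK[tK]].
    rewrite cardsU1 vt add1n => -[->]; split=> //.
    by rewrite inE disjoint_sym disjoints1 vt setUC.
  exists 0 => _; split; first by move=> s; rewrite ffunE eqxx.
  rewrite (_ : vertex_part v c = 0) ?boundary0 //; apply/ffunP => t.
  rewrite !ffunE; case: ifP => // _; have [->|/cK[tK _]] := eqVneq (c (v |: t)) 0.
    by rewrite mulr0.
  by case/negP: vK; apply: Kdown tK; rewrite sub1set setU11.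
pose c' := [ffun t : {set V} => if [disjoint t & W] then c t else 0] : {ffun {set V} -> F^o}.
have cE : c = c' + \sum_(v in W) cone v (vertex_part v c).
  apply/ffunP => t; rewrite ffunE sum_ffunE ffunE.
  have cv v : cone v (vertex_part v c) t = if v \in t then c t else 0.
    rewrite ffunE; case: ifP => // vt; rewrite ffunE !inE eqxx /= setD1K //.
    by rewrite mulrA -{1}(setD1K vt) incidenceU1xx incidence_sqr mul1r.
  rewrite (eq_bigr _ (fun v _ => cv v)).
  case: (boolP [disjoint t & W]) => [tW|/pred0Pn[v /andP[/= vt vW]]].
    rewrite big1 ?addr0 // => v vW; case: ifP => // vt.
    by move: tW => /pred0P /(_ v); rewrite /= vt vW.
  rewrite add0r (bigD1 v) //= vt big1 ?addr0 // => w /andP[wW wv].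
  case: ifP => // wt; apply/eqP/negPn/negP => /cK[tK _].
  by case/eqP: wv; apply: (K1 t).
exists (c' + \sum_(v in W) e v); last first.
  rewrite -dc [in RHS]cE !boundaryD !boundary_sum; congr (_ + _).
  apply: eq_bigr => v vW; rewrite boundary_cone ?dcv //.
    by have [_ ->] := eP v vW.
  by move=> t vt; rewrite ffunE vt.
move=> s; rewrite ffunE sum_ffunE ffunE => nz.
have [tW|tW] := boolP [disjoint s & W].
  have [/eqP|/cK[sK ->]] := boolP (c s == 0); last by rewrite inE sK tW.
  move=> cs0; move: nz; rewrite tW cs0 add0r => nz.
  have /existsP[v /andP[vW ev0]] : [exists v, (v \in W) && (e v s != 0)].
    apply: contraNT nz => /existsPn H; rewrite big1 // => v vW.
    by apply/eqP; move: (H v); rewrite vW negbK.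
  have [/(_ s ev0)[]] := eP v vW; rewrite !inE => /andP[_ sK] -> _; split=> //.
  by rewrite tW andbT; apply: Kdown sK; apply: subsetUl.
move: nz; rewrite (negPf tW) add0r => nz.
have /existsP[v /andP[vW ev0]] : [exists v, (v \in W) && (e v s != 0)].
  apply: contraNT nz => /existsPn H; rewrite big1 // => v vW.
  by apply/eqP; move: (H v); rewrite vW negbK.
have [/(_ s ev0)[]] := eP v vW; rewrite inE disjoint_sym disjoints1 => /andP[vs sK] _ _.
(* A vertex [w] of [s] in [W] would be a second vertex in [W], besides [v], of the face [v |: s]. *)
case/pred0Pn: tW => w /andP[/= ws wW]; case/negP: vs.
by rewrite (K1 _ sK v w) // !inE ?eqxx ?orbT // ws.
Qed.

End Homology.

(** * Selecting colours in a properly coloured complex *)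

Section ColourSelection.
Context (F : fieldType) (V I : finType) (K : {set {set V}}) (col : V -> I).
Hypothesis K_down : forall s t : {set V}, s \subset t -> t \in K -> s \in K.
Hypothesis col_inj : forall s, s \in K -> {in s &, injective col}.

Definition colour_selected (S : {set I}) : {set {set V}} :=
  [set s in K | col @: s \subset S].

Lemma colour_selected_setT : colour_selected setT = K.
Proof. by apply/setP => s; rewrite inE subsetT andbT. Qed.

Lemma link_colour_selectedU1 (S : {set I}) j (s : {set V}) : j \notin S ->
  s \in colour_selected S ->
  link (colour_selected S) s =
  [set t in link (colour_selected (j |: S)) s | [disjoint t & [set v | col v == j]]].
Proof.
move=> jS; rewrite inE => /andP[_ sS]; apply/setP => t.
rewrite !inE -!andbA; do 2!congr (_ && _); rewrite imsetU !subUset sS.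
rewrite (subset_trans sS (subsetUr _ _)) !andbT.
apply/subsetP/andP => [H|[/subsetP H /pred0P tj] _ /imsetP[v vt ->]].
  split; first by apply/subsetP => c /H; rewrite inE orbC => ->.
  apply/pred0P => v /=; rewrite inE; apply/negP => /andP[vt /eqP vj].
  by move: jS; rewrite -vj H // imset_f.
have := H _ (imset_f col vt); rewrite !inE => /predU1P[vj|//].
by have := tj v; rewrite /= vt inE vj eqxx.
Qed.

Lemma link_link (L : {set {set V}}) (s : {set V}) v : v \notin s ->
  link (link L s) [set v] = link L (v |: s).
Proof.
move=> vs; apply/setP => t; rewrite !inE setUA -!setI_eq0 setIUl setU_eq0 setIUr setU_eq0.
rewrite [[set v] :&: s](_ : _ = set0) ?eqxx ?andbT ?andbA //.
by apply/eqP; rewrite setI_eq0 disjoints1.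
Qed.

(* Removing one colour class at a time: if [v] has colour [j], the links of [v]
   in the complex selected by [j |: S] have the same expected dimension as the
   complex selected by [S]. *)
Lemma colour_selected_homology (S : {set I}) (s : {set V}) k :
  (forall s, s \in K -> forall k, (k < #|I| - #|s|)%N ->
     reduced_homology_eq0 F (link K s) k) ->
  s \in colour_selected S -> (k < #|S| - #|s|)%N ->
  reduced_homology_eq0 F (link (colour_selected S) s) k.
Proof.
(* Induction on the number of colours outside [S]; when there are none, the complex is [K]
   itself. *)
move=> HK; have [m] := ubnP #|~: S|; elim: m S s k => // m IH S s k.
rewrite ltnS => leSm sS kS.
have [/eqP SC|[j]] := set_0Vmem (~: S).
  have ST : S = setT by rewrite -(setCK S) (eqP SC) setC0.
  move: sS kS; rewrite ST colour_selected_setT cardsT. move=> sK kS; exact: (HK s sK k kS).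
rewrite inE => jS; have cardS1 : #|j |: S| = #|S|.+1 by rewrite cardsU1 jS.
have sub1 (t : {set V}) : t \in colour_selected S -> t \in colour_selected (j |: S).
  by rewrite !inE => /andP[-> /subset_trans-> //]; apply: subsetUr.
have ltm : (#|~: (j |: S)| < m)%N.
  apply: leq_trans leSm; apply: proper_card; apply/properP.
  by split; [rewrite setCS subsetUr|exists j; rewrite !inE ?eqxx].
rewrite (link_colour_selectedU1 jS sS).
apply: deletion_reduced_homology.
- move=> t u tu; rewrite !inE => /and3P[us uK uS].
  rewrite (disjointWl _ us) //=; apply/andP; split.
    by apply: K_down uK; apply: setSU.
  by apply: subset_trans uS; apply/imsetS/setSU.
- move=> t; rewrite !inE => /and3P[_ tK _] v w; rewrite !inE => /eqP vj /eqP wj vt wt.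
  by apply: (col_inj tK); rewrite ?inE ?vt ?wt // vj wj.
- by apply: IH => //; [exact: sub1|rewrite cardS1; lia].
move=> v _; rewrite inE => /andP[]; rewrite disjoints1 => vs vsK.
rewrite link_link //; apply: IH => //.
by rewrite cardS1 cardsU1 vs; lia.
Qed.

End ColourSelection.

(** * Sign of the Euler characteristic *)

Section EulerCharacteristic.
Context (F : numFieldType) (V : finType) (K : {set {set V}}).
Hypothesis K_down : forall s t : {set V}, s \subset t -> t \in K -> s \in K.
Implicit Types (s t : {set V}) (c z : {ffun {set V} -> F^o}).

Local Notation bd := (@boundary_lin F V).

(** The terms of the double sum for [(x, y)] and [(y, x)] are opposite, so the sum is its own
    negative, which forces 0 in characteristic 0. *)
Lemma boundary_boundary c : bd (bd c) = 0.
Proof.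
apply/ffunP => s; rewrite [LHS]boundaryE [RHS]ffunE.
pose G x y := if [&& x \notin s, y \notin s & x != y] then
  incidence F x s * incidence F y (x |: s) * c (y |: (x |: s)) else 0.
have -> : \sum_(x in ~: s) incidence F x s * bd c (x |: s) = \sum_x \sum_y G x y.
  rewrite big_mkcond; apply: eq_bigr => x _; rewrite inE.
  case: (boolP (x \in s)) => xs /=; first by rewrite big1 // => y _; rewrite /G xs.
  rewrite [bd _ _]boundaryE mulr_sumr big_mkcond; apply: eq_bigr => y _.
  rewrite /G xs !inE negb_or andbC eq_sym mulrA.
  by case: ifP => //; rewrite mulrA.
have TN : \sum_x \sum_y G x y = - \sum_x \sum_y G x y.
  rewrite {1}exchange_big -sumrN; apply: eq_bigr => x _; rewrite -sumrN.
  apply: eq_bigr => y _; rewrite /G eq_sym andbCA; case: ifP => [|_]; last by rewrite oppr0.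
  by move=> /and3P[xs ys xy]; rewrite incidence_swap 1?eq_sym // setUCA mulNr.
have /eqP : (\sum_x \sum_y G x y) *+ 2 = 0 by rewrite mulr2n {1}TN addNr.
by rewrite mulrn_eq0 => /eqP.
Qed.

Definition faces k := [set s in K | #|s| == k].

Definition face_chain s : {ffun {set V} -> F^o} := [ffun t => (t == s)%:R].

Definition face_tuple k : #|faces k|.-tuple {ffun {set V} -> F^o} :=
  map_tuple face_chain (enum_tuple (faces k)).

Definition chain_space k : {vspace {ffun {set V} -> F^o}} := <<face_tuple k>>%VS.

Lemma face_tupleE k (i : 'I_#|faces k|) : (face_tuple k)`_i = face_chain (enum_val i).
Proof. by rewrite -tnth_nth tnth_map (tnth_nth set0) /= -enum_val_nth. Qed.

Lemma chain_spaceP k c : reflect (simplicial_chain K k c) (c \in chain_space k).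
Proof.
apply: (iffP idP) => [/coord_span -> s|cK].
  rewrite sum_ffunE => nz.
  have : exists i : 'I_#|faces k|, s == enum_val i.
    apply/existsP; apply: contraNT nz => /existsPn H; rewrite big1 // => i _.
    by rewrite ffunE face_tupleE ffunE (negPf (H i)) /GRing.scale /= mulr0.
  move=> [i /eqP ->]; have := enum_valP i; rewrite inE => /andP[? /eqP]; by split.
have -> : c = \sum_(s in faces k) c s *: face_chain s.
  apply/ffunP => t; rewrite sum_ffunE.
  have [tk|tk] := boolP (t \in faces k).
    rewrite (bigD1 t) //= big1 => [|s /andP[_ st]].
      by rewrite !ffunE eqxx /GRing.scale /= mulr1 addr0.
    by rewrite !ffunE eq_sym (negPf st) /GRing.scale /= mulr0.
  rewrite big1 => [|s sk].
    by apply/eqP/negPn/negP => /cK[tK tc]; case/negP: tk; rewrite inE tK tc eqxx.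
  by rewrite !ffunE; case: eqP => [ts|_]; [rewrite ts sk in tk|rewrite /GRing.scale /= mulr0].
apply: memv_suml => s sk; apply/memvZ/memv_span.
by apply: map_f; rewrite mem_enum.
Qed.

Lemma dim_chain_space k : \dim (chain_space k) = #|faces k|.
Proof.
suff /eqP -> : free (face_tuple k) by rewrite size_tuple.
apply/freeP => a /ffunP H i; move: (H (enum_val i)); rewrite sum_ffunE ffunE => <-.
rewrite (bigD1 i) //= big1 => [|j ji].
  by rewrite ffunE face_tupleE ffunE eqxx /GRing.scale /= mulr1 addr0.
rewrite ffunE face_tupleE ffunE (inj_eq enum_val_inj) eq_sym (negPf ji).
by rewrite /GRing.scale /= mulr0.
Qed.

Lemma boundary_chain k c : simplicial_chain K k.+1 c -> simplicial_chain K k (bd c).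
Proof.
move=> cK s; rewrite [bd _ _]boundaryE => nz.
have /existsP[x /andP[xs cx]] : [exists x, (x \notin s) && (c (x |: s) != 0)].
  apply: contraNT nz => /existsPn H; rewrite big1 // => x; rewrite inE => xs.
  by move: (H x); rewrite xs negbK => /eqP ->; rewrite mulr0.
have [xK] := cK _ cx; rewrite cardsU1 xs add1n => -[->]; split=> //.
by apply: K_down xK; apply: subsetUr.
Qed.

Let r k := \dim (linfun bd @: chain_space k).

Let r0 : r 0 = 0%N.
Proof.
apply/eqP; rewrite dimv_eq0 -subv0; apply/subvP => _ /memv_imgP[c /chain_spaceP cK ->].
rewrite lfunE memv0; apply/eqP/ffunP => s; rewrite [LHS]boundaryE ffunE big1 // => x.
rewrite inE => xs; have [->|/cK[_ /eqP]] := eqVneq (c (x |: s)) 0; first by rewrite mulr0.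
by rewrite cardsU1 xs.
Qed.

Let linfunE c : linfun bd c = bd c.
Proof. by rewrite lfunE. Qed.

(** Rank-nullity, where vanishing homology identifies the kernel in this degree with the image of
    the next boundary map. *)
Let r_exact k : reduced_homology_eq0 F K k -> #|faces k| = (r k.+1 + r k)%N.
Proof.
move=> HK; rewrite -dim_chain_space -(limg_ker_dim (linfun bd)); congr (\dim _ + _)%N.
apply/eqP; rewrite eqEsubv; apply/andP; split; apply/subvP => c.
  rewrite memv_cap memv_ker linfunE => /andP[/chain_spaceP cK /eqP dc0].
  have [e eK <-] := HK c cK dc0.
  by rewrite -[boundary e]linfunE memv_img //; apply/chain_spaceP.
move=> /memv_imgP[e /chain_spaceP eK ->]; rewrite linfunE memv_cap memv_ker linfunE.
by rewrite boundary_boundary eqxx andbT; apply/chain_spaceP/boundary_chain.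
Qed.

(** By [r_exact] the alternating sum telescopes; what remains is the number of [m]-element faces
    minus the rank of their boundary map, the dimension of the space of top-degree cycles. *)
Lemma euler_char_ge0 (R : numDomainType) m :
  (forall s, s \in K -> (#|s| <= m)%N) ->
  (forall k, (k < m)%N -> reduced_homology_eq0 F K k) ->
  0 <= \sum_(s in K) (-1) ^+ (m - #|s|) :> R.
Proof.
move=> Km HK.
rewrite (partition_big (fun s => inord #|s| : 'I_m.+1) predT) //=.
have -> : \sum_(j < m.+1) \sum_(s in K | inord #|s| == j) (-1) ^+ (m - #|s|) =
    \sum_(j < m.+1) (-1) ^+ (m - j) * #|faces j|%:R :> R.
  apply: eq_bigr => j _.
  rewrite (eq_bigr (fun=> (-1) ^+ (m - j))) => [|s /andP[/Km sm /eqP <-]]; last first.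
    by rewrite inordK.
  rewrite sumr_const mulr_natr; congr (_ *+ _); apply: eq_card => s.
  rewrite [LHS]/in_mem /= !inE; apply: andb_id2l => /Km sm.
  by rewrite -val_eqE /= inordK.
have E : forall i, (i <= m)%N ->
    \sum_(j < i) (-1) ^+ (i - j) * #|faces j|%:R = - (r i)%:R :> R.
  elim=> [|i IH] im; first by rewrite big_ord0 r0 oppr0.
  rewrite big_ord_recr /= subSnn.
  rewrite (eq_bigr (fun j : 'I_i => - ((-1) ^+ (i - j) * #|faces j|%:R))); last first.
    by move=> j _; rewrite subSn 1?ltnW // exprS !mulN1r mulNr.
  rewrite sumrN IH 1?ltnW // opprK (r_exact (HK i im)) natrD.
  by rewrite expr1 mulN1r opprD addrCA subrr addr0.
rewrite big_ord_recr /= subnn E // mul1r addrC subr_ge0 ler_nat.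
by rewrite -dim_chain_space -(limg_ker_dim (linfun bd)) leq_addl.
Qed.

End EulerCharacteristic.

(** * Positivity of h for Cohen--Macaulay posets *)

Section NonnegativeHPolynomial.
Context {d : Order.disp_t} (L : finPOrderType d).
Local Notation N := (max_chain_card L).

Definition height (x : L) : nat :=
  \max_(C : {set L} | is_chain C && [forall y in C, (y < x)%O]) #|C|.

Lemma height_chain x : exists C : {set L},
  [/\ is_chain (x |: C), {in C, forall y, (y < x)%O} & #|x |: C| = (height x).+1].
Proof.
have [|C /andP[cC /forall_inP Cx] E] := @eq_bigmax_cond _
    (fun C : {set L} => is_chain C && [forall y in C, (y < x)%O]) (fun C : {set L} => #|C|).
  apply/card_gt0P; exists set0; rewrite [_ \in _]/= unfold_in /= is_chain_set0.
  by apply/forall_inP => y; rewrite inE.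
have xC : x \notin C by apply/negP => /Cx; rewrite ltxx.
have EC : #|C| = height x by rewrite -E.
exists C; split=> //; last by rewrite cardsU1 xC EC.
apply/is_chainP => y z; rewrite !inE.
move=> /predU1P[->|yC] /predU1P[->|zC]; first exact: comparablexx.
- by rewrite comparable_sym /Order.comparable ltW ?Cx.
- by rewrite /Order.comparable ltW ?Cx.
- by apply: (is_chainP _ cC).
Qed.

Lemma height_lt x : (height x < N)%N.
Proof. by have [C [cC _ <-]] := height_chain x; exact: is_chain_card. Qed.

Lemma height_homo x y : (x < y)%O -> (height x < height y)%N.
Proof.
move=> xy; have [C [cC Cx <-]] := height_chain x.
apply: (@leq_bigmax_cond _ _ (fun C : {set L} => #|C|)); rewrite cC.
by apply/forall_inP => z; rewrite !inE => /predU1P[->//|/Cx/lt_trans]; apply.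
Qed.

Definition rank_colour (x : L) : 'I_N := Ordinal (height_lt x).

Lemma rank_colour_inj (C : {set L}) : C \in order_complex L ->
  {in C &, injective rank_colour}.
Proof.
rewrite inE => /is_chainP cC x y xC yC [] E.
case: (comparable_ltgtP (cC x y xC yC)) => //; move=> /height_homo;
by rewrite E ltnn.
Qed.


Lemma order_complex_down (C D : {set L}) :
  C \subset D -> D \in order_complex L -> C \in order_complex L.
Proof. by rewrite !inE; exact: is_chainS. Qed.

Lemma max_chain_extends n (C : {set L}) : graded_of_rank L n -> is_chain C ->
  exists D : {set L}, [/\ C \subset D, is_chain D & #|D| = n.+1].
Proof.
move=> gL cC; have [D maxD CD] := maxset_exists cC.
by exists D; split=> //; [exact: maxsetp maxD|exact: gL].
Qed.

Local Notation selected := (colour_selected (order_complex L) rank_colour).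

(** For graded [L], the entry at [S] of the flag h-vector: up to sign, the reduced Euler
    characteristic of the subposet with ranks in [S]. *)
Definition selected_euler_char (R : nzRingType) (S : {set 'I_N}) : R :=
  \sum_(C in selected S) (-1) ^+ (#|S| - #|C|).

Lemma card_selected S C : C \in selected S -> (#|C| <= #|S|)%N.
Proof.
rewrite inE => /andP[cC /subset_leq_card].
by rewrite card_in_imset //; apply: rank_colour_inj.
Qed.

Lemma selected_euler_char_ge0 (R : numDomainType) n S :
  graded_of_rank L n -> cohen_macaulay L -> 0 <= selected_euler_char R S.
Proof.
move=> gL cm; apply: (@euler_char_ge0 rat).
- move=> C D CD; rewrite !inE => /andP[cD DS].
  by rewrite (is_chainS CD cD) /= (subset_trans _ DS) // imsetS.
- by move=> C; exact: card_selected.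
move=> k kS.
have S0 : set0 \in selected S by rewrite !inE is_chain_set0 imset0 sub0set.
have -> : selected S = link (selected S) set0.
  by apply/setP => C; rewrite [RHS]inE setU0 -setI_eq0 setI0 eqxx.
apply: colour_selected_homology S0 _; rewrite ?cards0 ?subn0 //.
- exact: order_complex_down.
- exact: rank_colour_inj.
move=> C cC k'; rewrite card_ord => k'N; apply: cm => //.
(* Gradedness enters here: [C] extends to a chain [D] of [N] elements, and [D :\: C] is a face of
   the link, so the Cohen--Macaulay hypothesis reaches all degrees needed. *)
apply: leq_trans k'N _; rewrite inE in cC.
have [D [CD cD cardD]] := max_chain_extends gL cC.
rewrite (graded_max_chain_card gL) -cardD.
have -> : (#|D| - #|C|)%N = #|D :\: C| by rewrite cardsD (setIidPr CD).
apply: (@leq_bigmax_cond _ _ (fun s : {set L} => #|s|)).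
have DC : D :\: C :|: C = D by rewrite -{2}(setIidPr CD) setUC setID.
by rewrite !inE DC cD -setI_eq0 setDE -setIA [~: C :&: C]setIC setICr setI0 eqxx.
Qed.

(** The term of [C] is a product over all [N] colours, with factor [x] at the colours of [C] and
    [1 - x] elsewhere. Expanding it gives one term for each set [S] of colours containing those of
    [C], with sign [(-1) ^ (|S| - |C|)]. *)
Lemma h_poly_selected (R : comNzRingType) :
  h_poly R L = \sum_(S : {set 'I_N}) selected_euler_char R S *: 'X^#|S|.
Proof.
rewrite h_polyE.
under [RHS]eq_bigr => S _ do rewrite scaler_suml big_mkcond /=.
rewrite exchange_big /= big_mkcond; apply: eq_bigr => C _.
case: ifPn => cC; last first.
  by rewrite big1 // => S _; rewrite inE [C \in _]inE (negPf cC).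
pose T := rank_colour @: C.
have cardT : #|T| = #|C| by rewrite card_in_imset //; apply: rank_colour_inj; rewrite inE.
transitivity (\prod_i ((if i \in T then 'X else - 'X : {poly R}) + (if i \in T then 0 else 1))).
  rewrite (bigID (mem T)) /= -cardT; congr (_ * _).
    rewrite (eq_bigr (fun=> 'X)) ?prodr_const // => i iT.
    by rewrite iT addr0.
  rewrite (eq_bigr (fun=> 1 - 'X)) ?prodr_const => [|i /negPf iT]; last by rewrite iT addrC.
  congr (_ ^+ _); rewrite -[X in (X - _)%N]card_ord -(cardC (mem T)) addKn.
  by apply: eq_card.
rewrite bigA_distr; apply: eq_bigr => S _.
rewrite [C \in _]inE [C \in _]inE cC /= -/T; case: ifPn => TS.
  rewrite (bigID (mem T)) /= (eq_bigr (fun=> 'X)) => [|i iT]; last first.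
    by rewrite iT (subsetP TS).
  rewrite prodr_const (bigID (mem S)) /= [X in _ * (_ * X)]big1 ?mulr1; last first.
    by move=> i /andP[/negPf -> /negPf ->].
  rewrite (eq_bigr (fun=> - 'X)) => [|i /andP[/negPf -> ->]] //.
  rewrite prodr_const -cardT.
  have -> : #|[pred i | (i \notin T) && (i \in S)]| = (#|S| - #|T|)%N.
    by rewrite -[in RHS](setIidPr TS) -cardsD; apply: eq_card => i; rewrite inE [RHS]inE.
  rewrite [in LHS]exprNn mulrCA -exprD subnKC ?subset_leq_card // -mul_polyC.
  by rewrite rmorphXn rmorphN1.
have /subsetPn[i iT iS] := TS.
by rewrite (bigD1 i) //= iT (negPf iS) mul0r.
Qed.

(** The constant coefficient is 1, coming from the empty chain, and the others are nonnegative. *)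
Lemma h_poly_gt0 (R : numDomainType) n (x : R) :
  graded_of_rank L n -> cohen_macaulay L -> 0 <= x -> 0 < (h_poly R L).[x].
Proof.
move=> gL cm x0; rewrite h_poly_selected horner_sum (bigD1 set0) //=.
apply: ltr_wpDr.
  apply: sumr_ge0 => S _; rewrite hornerZ hornerXn.
  by rewrite mulr_ge0 ?exprn_ge0 // (selected_euler_char_ge0 _ _ gL).
rewrite cards0 hornerZ hornerXn mulr1 /selected_euler_char (big_pred1 set0) => [|C].
  by rewrite !cards0 ltr01.
rewrite !inE subset0 imset_eq0 andb_idl // => /eqP ->.
exact: is_chain_set0.
Qed.

End NonnegativeHPolynomial.

(** * Interlacing *)

Section Interlacing.
Context {R : realType}.
Implicit Types (s t u : seq R) (f g h : {poly R}).

Let ge_trans : transitive (>=%R : rel R).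
Proof. by move=> y x z xy yz; apply: le_trans yz xy. Qed.

Let gt_trans : transitive (>%R : rel R).
Proof. by move=> y x z xy yz; apply: lt_trans yz xy. Qed.

Let ge_total : total (>=%R : rel R).
Proof. by move=> x y; apply: le_total. Qed.

(** In a decreasing list the terms above [x] form a prefix. *)
Lemma nth_gt_count s i x : sorted >=%R s -> (i < size s)%N ->
  (x < s`_i) = (i < count (> x) s)%N.
Proof.
rewrite (sorted_pairwise ge_trans).
elim: s i => // a s IH i /= /andP[/allP sa ss] si.
have [xa|ax] := ltP x a.
  by case: i si => [|i] si //=; rewrite add1n ltnS IH.
rewrite add0n (_ : count _ s = 0%N) ?ltn0; last first.
  apply/eqP; rewrite -leqn0 leqNgt -has_count; apply/hasPn => y /sa /= ya.
  by rewrite -leNgt (le_trans ya).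
apply/negbTE; rewrite -leNgt; apply: le_trans ax.
by case: i si => [|i] si //=; apply: sa; apply: mem_nth.
Qed.

(* Counting the terms beyond each threshold makes interlacing visibly stable
   under adding common terms to both sequences. *)
Lemma interlacing_seqsP s t : sorted >=%R s -> sorted >=%R t ->
  interlacing_seqs s t <->
  (size t = size s \/ size t = (size s).+1) /\
  forall x : R, (count (> x) s <= count (> x) t <= (count (> x) s).+1)%N.
Proof.
move=> ss st; split=> [[sz le_st le_ts]|[sz H]].
  split=> // x; have sx := count_size (> x) s; have tx := count_size (> x) t.
  apply/andP; split.
    case E: (count (> x) s) => [//|k]; rewrite E in sx.
    have kt : (k < size t)%N by case: sz => -> //; apply: leqW.
    rewrite -nth_gt_count //; apply: lt_le_trans (le_st k sx).
    by rewrite nth_gt_count // E.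
  case E: (count (> x) t) => [|[|k]] //; rewrite E in tx.
  have ks : (k < size s)%N by case: sz tx => -> // /ltnW.
  rewrite ltnS -nth_gt_count //; apply: lt_le_trans (le_ts k tx).
  by rewrite nth_gt_count // E.
split=> // i si; rewrite leNgt; apply/negP.
  have it : (i < size t)%N by case: sz => -> //; apply: leqW.
  rewrite nth_gt_count // => /leq_trans; case/andP: (H (t`_i)) => H1 _ /(_ _ H1).
  by rewrite -nth_gt_count // ltxx.
have is' : (i < size s)%N by case: sz si => -> // /ltnW.
rewrite nth_gt_count // => /leq_trans; case/andP: (H (s`_i)) => _ H2 /(_ _ H2).
by rewrite ltnS -nth_gt_count // ltxx.
Qed.

Lemma interlacing_seqs_cat s t u : sorted >=%R s -> sorted >=%R t ->
  interlacing_seqs s t ->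
  interlacing_seqs (sort >=%R (s ++ u)) (sort >=%R (t ++ u)).
Proof.
move=> ss st /(interlacing_seqsP ss st)[sz H].
apply/interlacing_seqsP; rewrite ?sort_sorted //; split.
  by rewrite !size_sort !size_cat; case: sz => ->; [left|right].
move=> x; rewrite !count_sort !count_cat.
by case/andP: (H x) => H1 H2; rewrite leq_add2r H1 -addSn leq_add2r.
Qed.

Lemma decreasing_roots_sort f s : f = lead_coef f *: \prod_(a <- s) ('X - a%:P) ->
  decreasing_roots f (sort >=%R s).
Proof.
move=> fE; split; first exact: sort_sorted.
by rewrite {1}fE; congr (_ *: _); apply: perm_big; rewrite perm_sym perm_sort.
Qed.

Lemma real_rooted_split f : real_rooted f -> f != 0 ->
  exists s, decreasing_roots f s.
Proof.
move=> [->|rf]; first by rewrite eqxx.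
move=> f0; have [r fE] := closed_field_poly_normal (map_poly (real_complex R) f).
exists (sort >=%R (map (@complex.Re R) r)); apply: decreasing_roots_sort.
apply: (@map_poly_inj _ _ (real_complex R)).
rewrite {1}fE lead_coef_map map_polyZ rmorph_prod big_map; congr (_ *: _).
apply: eq_big_seq => z zr; rewrite /= map_polyXsubC; congr ('X - _%:P).
have /rf : root (map_poly (real_complex R) f) z.
  rewrite fE rootE hornerZ mulf_eq0; apply/orP; right.
  by rewrite -/(root _ z) root_prod_XsubC.
by case: z {zr} => a b /= ->.
Qed.

Lemma split_real_rooted f s : f = lead_coef f *: \prod_(a <- s) ('X - a%:P) ->
  real_rooted f.
Proof.
move=> fE; have [f0|f0] := eqVneq f 0; [by left|right].
move=> z; rewrite fE map_polyZ rootZ ?fmorph_eq0 ?lead_coef_eq0 // rmorph_prod.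
rewrite (eq_bigr (fun a => 'X - (real_complex R a)%:P)) => [|a _]; last first.
  exact: map_polyXsubC.
rewrite -(big_map (real_complex R) predT (fun a => 'X - a%:P)) root_prod_XsubC.
by case/mapP => a _ ->.
Qed.

(** The logarithmic derivative, a sum of [mult(a) / (x - a)] over the distinct roots, cleared of
    denominators; [u] holds the surplus copies of the roots, the common factor of the product and
    its derivative. *)
Lemma deriv_prod_undup s : exists u,
  [/\ perm_eq s (undup s ++ u) &
    (\prod_(a <- s) ('X - a%:P))^`() =
      (\sum_(a <- undup s) (count_mem a s)%:R *: \prod_(b <- undup s | b != a) ('X - b%:P))
      * \prod_(b <- u) ('X - b%:P)].
Proof.
elim: s => [|a s [u [pu IH]]].
  by exists [::]; split=> //; rewrite !big_nil derivC mul0r.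
have sE : \prod_(b <- s) ('X - b%:P) =
    (\prod_(b <- undup s) ('X - b%:P)) * \prod_(b <- u) ('X - b%:P).
  by rewrite (perm_big _ pu) big_cat.
have key (P : {poly R}) : \prod_(b <- a :: s) ('X - b%:P) = ('X - a%:P) * P ->
    (\prod_(b <- a :: s) ('X - b%:P))^`() = P + ('X - a%:P) * P^`().
  by move=> ->; rewrite derivM derivXsubC mul1r.
rewrite (key _ (big_cons _ _ _ _ _ _)) IH {key} /=.
have [as_|as_] := boolP (a \in s).
  exists (a :: u); split.
    by rewrite perm_sym perm_catC /= perm_cons perm_catC perm_sym.
  have asu : a \in undup s by rewrite mem_undup.
  have -> : \sum_(b <- undup s) ((a == b) + count_mem b s)%N%:R
        *: \prod_(c <- undup s | c != b) ('X - c%:P) =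
      \prod_(c <- undup s | c != a) ('X - c%:P) + \sum_(b <- undup s)
        (count_mem b s)%:R *: \prod_(c <- undup s | c != b) ('X - c%:P).
    under [LHS]eq_bigr => b _ do rewrite natrD scalerDl.
    rewrite big_split /=; congr (_ + _).
    rewrite [LHS](bigD1_seq a) ?undup_uniq //= eqxx scale1r [X in _ + X]big1 ?addr0 // => b ba.
    by rewrite eq_sym (negPf ba) scale0r.
  rewrite sE big_cons (bigD1_seq a) ?undup_uniq //=.
  set A := \prod_(b <- _ | _) _; set B := \sum_(b <- _) _; set C := \prod_(b <- u) _.
  by move: A B C ('X - a%:P) => A B C D; ring.
have asu : a \notin undup s by rewrite mem_undup.
exists u; split; first by rewrite /= perm_cons.
rewrite !big_cons eqxx /= add1n (count_memPn as_) scale1r.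
have -> : \prod_(c <- undup s | c != a) ('X - c%:P) = \prod_(c <- undup s) ('X - c%:P).
  rewrite big_seq_cond [RHS]big_seq; apply: eq_bigl => b.
  by case: (boolP (b \in undup s)) => //= bs; apply: contraNneq asu => <-.
have -> : \sum_(b <- undup s) ((a == b) + count_mem b s)%N%:R
      *: \prod_(c <- a :: undup s | c != b) ('X - c%:P) =
    ('X - a%:P) * \sum_(b <- undup s)
      (count_mem b s)%:R *: \prod_(c <- undup s | c != b) ('X - c%:P).
  rewrite mulr_sumr; apply: eq_big_seq => b bs.
  have ab : a != b by apply: contraNneq asu => ->.
  by rewrite big_cons ab (negPf ab) scalerAr.
rewrite sE; set A := \prod_(b <- _) _; set B := \sum_(b <- _) _; set C := \prod_(b <- u) _.
by move: A B C ('X - a%:P) => A B C D; ring.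
Qed.

(** Exactly the [i] entries listed before the one at index [i] give negative factors. *)
Lemma prod_others_sign s i : sorted >%R s -> (i < size s)%N ->
  0 < (-1) ^+ i * \prod_(b <- s | b != s`_i) (s`_i - b).
Proof.
rewrite (sorted_pairwise gt_trans) => ss si.
move: ss; rewrite -{1}(cat_take_drop i s) (drop_nth 0 si) pairwise_cat /=.
move=> /and4P[/allrelP gt_s _ /allP lt_s _].
have -> (F : R -> R) (P : pred R) : \prod_(b <- s | P b) F b =
    \prod_(b <- take i s ++ s`_i :: drop i.+1 s | P b) F b.
  by rewrite -(drop_nth 0 si) cat_take_drop.
rewrite big_cat big_cons eqxx /=.
have -> : (-1) ^+ i = \prod_(b <- take i s | b != s`_i) (-1) :> R.
  rewrite big_seq_cond (eq_bigl (fun b => b \in take i s)) => [|b]; last first.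
    rewrite andb_idr // => /gt_s /(_ (mem_head _ _)) /= bs.
    by rewrite gt_eqF.
  by rewrite -big_seq big_const_seq count_predT iter_mulr_1 size_takel // ltnW.
rewrite mulrA -big_split mulr_gt0 //= big_seq_cond; apply: prodr_gt0 => b /andP[bs _].
  have := gt_s _ _ bs (mem_head _ _); rewrite /= => bi.
  by rewrite mulN1r opprB subr_gt0.
by have := lt_s _ bs; rewrite /= subr_gt0.
Qed.

(** * Locating the roots once the common factor is removed *)

Section SimpleRoots.
Variables (s : seq R) (w : R -> R) (c : R).
Hypotheses (s_sorted : sorted >%R s) (s_lt0 : {in s, forall a, a < 0}).
Hypotheses (w_gt0 : {in s, forall a, 0 < w a}) (w_lt : \sum_(a <- s) w a < c).

Local Notation H := (\prod_(a <- s) ('X - a%:P)).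
Local Notation W := (\sum_(a <- s) w a *: \prod_(b <- s | b != a) ('X - b%:P)).

(** With [H] the squarefree part of [h] and [w] the multiplicities times [m], this is, up to a
    constant, [(1 + c x) h + m (x - x^2) h'] divided by the common factor of [h] and [h']. *)
Definition pencil := (1 + c *: 'X) * H + ('X - 'X^2) * W.

Let s_uniq : uniq s.
Proof. by apply: (sorted_uniq gt_trans _ s_sorted) => x; rewrite /= ltxx. Qed.

Let size_others a : a \in s -> size (\prod_(b <- s | b != a) ('X - b%:P)) = size s.
Proof.
move=> as_; rewrite -big_filter size_prod_XsubC -rem_filter // size_rem //.
by case: (s) as_.
Qed.

(** The coefficient of degree [size s + 1] is [c] minus the sum of the weights, positive by
    [w_lt]. *)
Lemma size_pencil : size pencil = (size s).+2 /\ 0 < lead_coef pencil.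
Proof.
have sW i : (size s <= i)%N -> W`_i = 0.
  move=> si; rewrite coef_sum big_seq big1 // => a as_.
  by rewrite coefZ nth_default ?mulr0 // size_others.
have topW : (0 < size s)%N -> W`_(size s).-1 = \sum_(a <- s) w a.
  move=> s0; rewrite coef_sum big_seq [RHS]big_seq; apply: eq_bigr => a as_.
  rewrite coefZ -[in X in _ * _`_X](size_others as_) -lead_coefE.
  by rewrite lead_coef_prod_XsubC mulr1.
have sH i : (size s < i)%N -> H`_i = 0.
  by move=> si; rewrite nth_default // size_prod_XsubC.
have topH : H`_(size s) = 1.
  by have := @lead_coef_prod_XsubC R R s predT id; rewrite lead_coefE size_prod_XsubC.
have E i : pencil`_i.+1 = H`_i.+1 + c * H`_i + (W`_i - (if i is j.+1 then W`_j else 0)).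
  rewrite /pencil mulrDl mul1r -scalerAl mulrBl expr2 -mulrA.
  rewrite !(coefD, coefN, coefZ, coefXM) /=; congr (_ + (_ - _)).
  by case: i.
have top : 0 < pencil`_(size s).+1.
  rewrite E topH sH // sW // mulr1 add0r sub0r subr_gt0.
  case E0: (size s) => [|n]; last by move: topW; rewrite E0 => ->.
  by move: w_lt; rewrite (size0nil E0) big_nil.
have sz : size pencil = (size s).+2.
  apply/eqP; rewrite eqn_leq; apply/andP; split.
    apply/leq_sizeP => -[//|[//|i]] si; rewrite E !sH ?sW // ?(leqW si) // ?mulr0 ?subrr ?addr0 //;
      exact: leqW.
  by rewrite ltnNge; apply/negP => /leq_sizeP/(_ _ (leqnn _)) H0; rewrite H0 ltxx in top.
by rewrite lead_coefE sz.
Qed.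

Lemma horner_pencil x :
  pencil.[x] = (1 + c * x) * H.[x] + (x - x ^+ 2) * W.[x].
Proof. by rewrite /pencil; move: H W => p q; rewrite !hornerE. Qed.

(** At 0 only [H] contributes, a product of positive factors. At a root of [H] only [(x - x^2) W]
    does: [x - x^2] is negative there and [W] has the sign given by [prod_others_sign]. *)
Lemma pencil_node i : (i <= size s)%N -> 0 < (-1) ^+ i * pencil.[(0 :: s)`_i].
Proof.
case: i => [_|i si].
  rewrite mul1r horner_pencil /= expr0n subr0 mul0r addr0 mulr0 addr0 mul1r.
  rewrite horner_prod big_seq; apply: prodr_gt0 => a /s_lt0 a0.
  by rewrite !hornerE ?add0r ?sub0r oppr_gt0.
have ss : s`_i \in s by apply: mem_nth.
have Ha : H.[s`_i] = 0 by apply/rootP; rewrite root_prod_XsubC.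
have Wa : W.[s`_i] = w s`_i * \prod_(b <- s | b != s`_i) (s`_i - b).
  rewrite horner_sum [LHS](bigD1_seq s`_i) //= [X in _ + X]big1 ?addr0 => [|a ai].
    by rewrite hornerZ horner_prod; congr (_ * _); apply: eq_bigr => b _; rewrite !hornerE.
  rewrite hornerZ horner_prod (big_rem s`_i) //= eq_sym ai.
  by rewrite hornerXsubC subrr mul0r mulr0.
have := prod_others_sign s_sorted si; have := s_lt0 ss; have := w_gt0 ss.
rewrite /= horner_pencil Ha Wa mulr0 add0r exprS.
move: (\prod_(b <- s | _) _) => P; move: (w s`_i) => v; move: (s`_i) ((-1) ^+ i) => x e v0 x0 eP.
have -> : -1 * e * ((x - x ^+ 2) * (v * P)) = (e * P) * v * (- x * (1 - x)) by ring.
have x1 : 0 < 1 - x by rewrite subr_gt0 (lt_trans x0).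
by apply: mulr_gt0; [exact: mulr_gt0|apply: mulr_gt0; rewrite ?oppr_gt0].
Qed.

(** The nodes are 0 and the entries of [s]. The sign changes give a root in every gap between
    consecutive nodes and one below the last node, [size s + 1] roots in all, which is the
    degree. *)
Lemma interlacing_simple : exists t, [/\ sorted >%R t, interlacing_seqs s t &
  pencil = lead_coef pencil *: \prod_(a <- t) ('X - a%:P)].
Proof.
have [szG lcG] := size_pencil; pose x := 0 :: s.
have x_sorted : sorted >%R x.
  by rewrite /x /=; case: (s) s_lt0 s_sorted => //= a s' lt0 ->; rewrite lt0 ?mem_head.
have x_lt i : (i < size s)%N -> x`_i.+1 < x`_i.
  by move=> si; have /(sortedP 0) := x_sorted; apply.
have root_in i : exists y : R, (i <= size s)%N ->
    [/\ root pencil y, y < x`_i & (i < size s)%N -> x`_i.+1 < y].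
  have [|si] := ltnP (size s) i; first by exists 0.
  move: (si); rewrite leq_eqVlt => /orP[/eqP is_|lt_is].
    (* Without a root up to the last node, the sign there would be the sign at -oo, namely
       [(-1) ^ (size s + 1)], against [pencil_node]. *)
    have [[y yx ry]|noroot] := pselect (exists2 y, y <= x`_i & root pencil y).
      exists y => _; split; rewrite ?is_ ?ltnn //.
      rewrite lt_neqAle -is_ yx andbT; apply/eqP => yE.
      by have := pencil_node si; rewrite -/x -yE (rootP ry) mulr0 ltxx.
    have /sgp_minftyP/(_ x`_i) : {in `]-oo, x`_i], forall y, ~~ root pencil y}.
      by move=> y; rewrite in_itv /= => yx; apply/negP => ry; apply: noroot; exists y.
    rewrite in_itv /= lexx => /(_ isT).
    rewrite /sgp_minfty szG /= sgrM (gtr0_sg lcG) mulr1 sgrX sgrN1 => Hs.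
    have := pencil_node si; rewrite -/x -sgr_gt0 sgrM Hs sgrX sgrN1 is_.
    by rewrite [in X in _ * X]exprS mulN1r mulrN -expr2 sqrr_sign oppr_gt0 ltr10.
  have [|y yI ry] := @poly_ivtoo _ pencil _ _ (ltW (x_lt i lt_is)).
    have := pencil_node si; have := pencil_node lt_is; rewrite -/x exprS.
    move: (pencil.[_]) (pencil.[_]) => p q.
    rewrite -[(-1) ^+ i](signr_odd); case: (odd i); rewrite /= ?expr0 ?expr1 => p0 q0; nra.
  exists y => _; move: yI; rewrite in_itv /= => /andP[? ?].
  by split.
have /choice[t_ tP] := root_in.
pose t := mkseq t_ (size s).+1.
have tE i : (i <= size s)%N -> t`_i = t_ i by move=> si; rewrite nth_mkseq.
have t_sorted : sorted >%R t.
  apply/(sortedP 0) => i; rewrite size_mkseq ltnS => si; change (t`_i.+1 < t`_i).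
  rewrite !tE ?(ltnW si) //; have [_ _ /(_ si)] := tP i (ltnW si).
  move=> H1; apply: lt_trans H1. by have [] := tP _ si.
exists t; split=> //.
  split; first by right; rewrite size_mkseq.
    by move=> i si; rewrite tE ?(ltnW si) // ltW //; have [_ _ /(_ si)] := tP i (ltnW si).
  by move=> i; rewrite size_mkseq ltnS => si; rewrite tE // ltW //; have [] := tP _ si.
apply: all_roots_prod_XsubC; first by rewrite szG size_mkseq.
  apply/(all_nthP 0) => i; rewrite size_mkseq ltnS => si; rewrite tE //.
  by have [] := tP i si.
by rewrite uniq_rootsE; apply: (sorted_uniq gt_trans _ t_sorted) => y; rewrite /= ltxx.
Qed.

End SimpleRoots.

(** * Putting back the common roots *)

Lemma sorted_gt_undup s : sorted >%R (sort >=%R (undup s)).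
Proof.
have : uniq (sort >=%R (undup s)) by rewrite sort_uniq undup_uniq.
have : sorted >=%R (sort >=%R (undup s)) by rewrite sort_sorted.
rewrite (sorted_pairwise ge_trans) (sorted_pairwise gt_trans) uniq_pairwise => ge_s ne_s.
have : pairwise [rel x y : R | (x >= y) && (x != y)] (sort >=%R (undup s)).
  by rewrite pairwise_relI ge_s.
by apply: sub_pairwise => x y /=; rewrite lt_neqAle eq_sym andbC.
Qed.

Lemma sum_count_undup s : \sum_(a <- undup s) (count_mem a s)%:R = (size s)%:R :> R.
Proof.
rewrite -(perm_size (perm_count_undup s)) size_flatten /shape -map_comp sumnE big_map.
by rewrite natr_sum; apply: eq_bigr => a _ /=; rewrite size_nseq.
Qed.

(** [interlacing_simple] is applied to the distinct roots [v], each weighted by [m] times its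
    multiplicity, so that the weights add up to [m * size s < c]. The surplus roots [u] are then
    appended to both lists, which [interlacing_seqs_cat] allows. *)
Lemma interlaces_pencil h s (m c : R) :
  h = lead_coef h *: \prod_(a <- s) ('X - a%:P) ->
  {in s, forall a, a < 0} -> 0 < m -> m * (size s)%:R < c ->
  interlaces h ((1 + c *: 'X) * h + m *: (('X - 'X^2) * h^`())).
Proof.
move=> hE s_lt0 m0 mc; set g := _ + _.
have [u [pu dE]] := deriv_prod_undup s.
pose v := sort >=%R (undup s); pose w a := m * (count_mem a s)%:R.
have pv : perm_eq v (undup s) by rewrite perm_sort.
have vs a : a \in v -> a \in s by rewrite (perm_mem pv) mem_undup.
have [t [t_sorted vt pencilE]] : exists t, [/\ sorted >%R t, interlacing_seqs v t &
    pencil v w c = lead_coef (pencil v w c) *: \prod_(a <- t) ('X - a%:P)].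
  apply: interlacing_simple.
  - exact: sorted_gt_undup.
  - by move=> a /vs; exact: s_lt0.
  - by move=> a /vs av; rewrite mulr_gt0 // ltr0n -has_count has_pred1.
  - by rewrite (perm_big _ pv) -mulr_sumr sum_count_undup.
have ge_of_gt (r : seq R) : sorted >%R r -> sorted >=%R r.
  by apply: sub_sorted => x y /ltW.
have hE' : h = lead_coef h *: \prod_(a <- v ++ u) ('X - a%:P).
  rewrite {1}hE (perm_big _ pu); congr (_ *: _); apply: perm_big.
  by rewrite perm_cat2r perm_sym.
have gE' : g = lead_coef h * lead_coef (pencil v w c) *: \prod_(a <- t ++ u) ('X - a%:P).
  rewrite big_cat /= -scalerA scalerAl -pencilE /pencil.
  have -> : \sum_(a <- v) w a *: \prod_(b <- v | b != a) ('X - b%:P) =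
      m *: \sum_(a <- undup s) (count_mem a s)%:R *: \prod_(b <- undup s | b != a) ('X - b%:P).
    rewrite (perm_big _ pv) scaler_sumr; apply: eq_bigr => a _.
    by rewrite (perm_big _ pv) scalerA.
  rewrite /g [in h^`()]hE derivZ dE [X in _ * X + _]hE' big_cat.
  rewrite -!mul_polyC /=.
  move: (\prod_(b <- v) _) (\prod_(b <- u) _) (\sum_(a <- _) _) => A B C.
  by move: (lead_coef h)%:P m%:P c%:P ('X : {poly R}) => a b e x; ring.
have gE : g = lead_coef g *: \prod_(a <- t ++ u) ('X - a%:P).
  by rewrite {1}gE'; congr (_ *: _); rewrite gE' lead_coefZ lead_coef_prod_XsubC mulr1.
split; [exact: split_real_rooted hE|exact: split_real_rooted gE|constructor 3].
exists (sort >=%R (v ++ u)), (sort >=%R (t ++ u)); split.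
- exact: decreasing_roots_sort.
- exact: decreasing_roots_sort.
by apply: interlacing_seqs_cat => //; apply: ge_of_gt => //; apply: sorted_gt_undup.
Qed.

End Interlacing.

Theorem theorem5p5 (R : realType) (d : Order.disp_t) (L : finTBPOrderType d)
    (n : nat) (n_gt0 : (0 < n)%N) (L_graded : graded_of_rank L n) :
  [/\ h_poly R (pyr L) =
        (1 + n%:R *: 'X) * h_poly R L + ('X - 'X^2) * (h_poly R L)^`(),
      h_poly R (prism L) =
        (1 + (2 * n - 1)%:R *: 'X) * h_poly R L
        + 2%:R *: (('X - 'X^2) * (h_poly R L)^`())
    & h_poly R (prism L) =
        2%:R *: h_poly R (pyr L) - (1 + 'X) * h_poly R L]
  /\
  (cohen_macaulay L -> real_rooted (h_poly R L) ->
   [/\ real_rooted (h_poly R (pyr L)),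
       real_rooted (h_poly R (prism L)),
       interlaces (h_poly R L) (h_poly R (pyr L))
     & interlaces (h_poly R L) (h_poly R (prism L))]).
Proof.
have pyrE := h_poly_pyr L_graded R; have prismE := h_poly_prism n_gt0 L_graded R.
split.
  split=> //; rewrite prismE pyrE -!mul_polyC !rmorph_nat natrB ?muln_gt0 // natrM.
  by move: (h_poly R L)^`() (h_poly R L) ('X : {poly R}) (n%:R) => h' h x c; ring.
move=> L_cm rr; set h := h_poly R L in rr pyrE prismE *.
have h_gt0 x : 0 <= x -> 0 < h.[x] by apply: h_poly_gt0 L_graded L_cm.
have h0 : h != 0 by apply: contraTneq (h_gt0 0 (lexx 0)) => ->; rewrite horner0 ltxx.
have [s [_ hE]] := real_rooted_split rr h0.
have s_lt0 : {in s, forall a, a < 0}.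
  move=> a as_; rewrite ltNge; apply/negP => /h_gt0.
  rewrite hE hornerZ (rootP _) ?mulr0 ?ltxx //.
  by rewrite root_prod_XsubC.
(* This bound serves both cases: [size s < n] for the pyramid, and [2 * size s <= 2 n - 2 < 2 n - 1]
   for the prism. *)
have sn : (size s < n)%N.
  have := size_h_poly_graded n_gt0 L_graded R; rewrite -/h hE size_scale ?lead_coef_eq0 //.
  by rewrite size_prod_XsubC.
have pyr_int : interlaces h (h_poly R (pyr L)).
  have := interlaces_pencil (m := 1) (c := n%:R) hE s_lt0 ltr01.
  by rewrite mul1r ltr_nat scale1r -pyrE; apply.
have prism_int : interlaces h (h_poly R (prism L)).
  have := interlaces_pencil (m := 2) (c := (2 * n - 1)%:R) hE s_lt0 (ltr0Sn _ 1).
  rewrite -prismE; apply; rewrite -natrM ltr_nat.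
  by lia.
by case: (pyr_int) (prism_int) => [_ ? _] [_ ? _]; split.
Qed.
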